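(* For every integer $k\geq 3$, \[ \frac{Q(k)}{\varphi(k)}=e-\frac{1}{e}+O\left(k^{-1/2}\log\log k\right), \] where the implied constant is absolute. In particular $\lim_{k\to\infty}Q(k)/\varphi(k)=e-1/e$.
   Context: For a real $x\in[e^{-e},e^{1/e}]$, the sequence $x,\ x^x,\ x^{x^x},\ldots$ converges; its limit is denoted $h(x)$, and it satisfies $h(x)=x^{h(x)}$, $1/e\leq h(x)\leq e$. For an algebraic number $A$, $\mathrm{ord}(A):=\min\{n\in\mathbb{N}: A^n\in\mathbb{Q}\}$ if such $n$ exists, and $\infty$ otherwise. $Q(k):=\#\{A\in\mathbb{A}\cap[e^{-e},e^{1/e}] : h(A)\text{ is algebraic and }\mathrm{ord}(A)=k\}$ (this set is finite), where $\mathbb{A}$ is the set of algebraic numbers. $\varphi$ is Euler's totient function. *)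

(* Defs.v *)
From Stdlib Require Import Reals Lra Lia ZArith Arith List.
Open Scope R_scope.

Definition zpoly_eval (l : list Z) (x : R) : R :=
  fold_right (fun c acc => IZR c + x * acc) 0 l.

Definition is_algebraic (x : R) : Prop :=
  exists l : list Z, (exists c, In c l /\ c <> 0%Z) /\ zpoly_eval l x = 0.

Definition is_rational (x : R) : Prop :=
  exists p q : Z, q <> 0%Z /\ x = IZR p / IZR q.

Fixpoint tower (x : R) (n : nat) : R :=
  match n with
  | O => x
  | S m => Rpower x (tower x m)
  end.

Definition h_algebraic (x : R) : Prop :=
  exists L : R, Un_cv (tower x) L /\ is_algebraic L.

Definition ord_eq (A : R) (k : nat) : Prop :=
  (1 <= k)%nat /\ is_rational (A ^ k) /\
  (forall m : nat, (1 <= m)%nat -> (m < k)%nat -> ~ is_rational (A ^ m)).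

Definition Qset (k : nat) (A : R) : Prop :=
  is_algebraic A /\ exp (- exp 1) <= A <= exp (/ exp 1) /\
  h_algebraic A /\ ord_eq A k.

Definition totient (k : nat) : nat :=
  length (filter (fun i => Nat.eqb (Nat.gcd i k) 1) (seq 1 k)).

(* Main.v *)
(* Let [L = h(A)], so that [A = L^(1/L)] with [1/e <= L <= e].

   If [A^k] is rational then [L] is rational: this is the Gelfond-Schneider theorem, which
   in this real case has an elementary proof by interpolation determinants.  The [N = n^4]
   functions [x^i A^(j x)] ([i < n^3], [j < n]) are evaluated at the [N] points
   [k s + L t] ([s, t < n^2]).  If [L] were irrational, these points would be distinct, and
   the determinant nonzero because a real exponential polynomial with [N] coefficients has
   fewer than [N] zeros (Rolle).  It is [exp (- N^2 (log n) / 2 + O(N^2))] by the mean value theorem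
   for divided differences, but at least [exp (- O(N n^3 log n))] because its entries are
   polynomials in the algebraic number [L] with small coefficients.

   Write [L = p/q] in lowest terms.  Then [ord A = k] forces [p = k t = m^t] and [q = l^t].
   The case [t = 1] consists of the integers [q] in [[k/e, e k]] coprime to [k], up to
   those for which [k] and [q] are [t]-th powers with [t > 1]; sieving by the prime divisors
   of [k] counts them as [(e - 1/e) phi(k) + O(2^omega(k))], and [4^omega(k) = O(sqrt k)].
   For [t > 1] there are at most [3 phi(m)] values of [l], where [phi(m) <= (m/k) phi(k)]
   and [m = O(sqrt k / t^2)].  So the error is in fact [O(k^(-1/2))], and a lower bound
   for [phi] with a [log log] is not needed. *)
Require Import Defs.
From Stdlib Require Import Reals List Lra Lia.
From mathcomp Require all_boot all_order all_algebra all_fingroup boolp Rstruct.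
From mathcomp Require ring lra zify ssrZ.
Open Scope R_scope.

(** * Limits of power towers *)

Lemma ln_lt_sub1 (z : R) : 0 < z -> z <> 1 -> ln z < z - 1.
Proof.
intros z0 z1.
assert (ln z <> 0) as n0 by (intro E; apply z1; rewrite <- (exp_ln z z0), E; apply exp_0).
generalize (exp_ineq1 (ln z) n0); rewrite (exp_ln z z0); lra.
Qed.

(** By [ln z < z - 1] at [z = x / y], [y ln x < y ln y - (y - x)]; and [(y - x) ln y <= y - x]
    because [y <= e]. *)
Lemma ln_div_lt (x y : R) : 0 < x -> x < y -> y <= exp 1 -> ln x / x < ln y / y.
Proof.
intros x0 xy ye.
assert (ln y <= 1) by (rewrite <- (ln_exp 1); destruct ye as [ye| ->]; [left; apply ln_increasing|]; lra).
assert (ln (x / y) < x / y - 1).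
{ apply ln_lt_sub1; [apply Rdiv_lt_0_compat; lra|].
  intro E. assert (x = y) by (replace x with (x / y * y) by (field; lra); rewrite E; lra). lra. }
assert (ln x = ln y + ln (x / y)) as E.
{ rewrite <- ln_mult; [f_equal; field|..]; try apply Rdiv_lt_0_compat; lra. }
apply (Rmult_lt_reg_r (x * y)); [nra|].
replace (ln x / x * (x * y)) with (y * ln x) by (field; lra).
replace (ln y / y * (x * y)) with (x * ln y) by (field; lra).
rewrite E.
assert (y * ln (x / y) < x - y).
{ replace (x - y) with (y * (x / y - 1)) by (field; lra). apply Rmult_lt_compat_l; lra. }
nra.
Qed.

Lemma ln_div_inj (x y : R) : 0 < x -> 0 < y -> x <= exp 1 -> y <= exp 1 ->
  ln x / x = ln y / y -> x = y.
Proof.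
intros x0 y0 xe ye E.
destruct (Rtotal_order x y) as [l|[l|l]]; trivial.
- generalize (ln_div_lt x y x0 l ye); lra.
- generalize (ln_div_lt y x y0 l xe); lra.
Qed.

Lemma Rpower_incr (A x y : R) : 1 <= A -> x <= y -> Rpower A x <= Rpower A y.
Proof. intros A1 xy; destruct xy as [xy| ->]; [apply Rle_Rpower|]; lra. Qed.

Lemma Rpower_decr (A x y : R) : 0 < A < 1 -> x < y -> Rpower A y < Rpower A x.
Proof.
intros [A0 A1] xy. unfold Rpower. apply exp_increasing.
assert (ln A < 0) by (rewrite <- ln_1; apply ln_increasing; lra). nra.
Qed.

Lemma Rpower_pos (A x : R) : 0 < Rpower A x.
Proof. apply exp_pos. Qed.

Lemma derivable_Rpower_exponent (A x : R) :
  derivable_pt_lim (Rpower A) x (Rpower A x * ln A).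
Proof.
unfold Rpower.
apply (derivable_pt_lim_comp (fun x => x * ln A) exp).
- assert (D := derivable_pt_lim_mult id (fun _ => ln A) x 1 0
    (derivable_pt_lim_id x) (derivable_pt_lim_const (ln A) x)).
  rewrite Rmult_1_l, Rmult_0_r, Rplus_0_r in D. exact D.
- apply derivable_pt_lim_exp.
Qed.

Lemma continuity_Rpower_exponent (A x : R) : continuity_pt (Rpower A) x.
Proof.
apply derivable_continuous_pt. exists (Rpower A x * ln A). apply derivable_Rpower_exponent.
Qed.

Lemma Un_cv_Rpower (A : R) (u : nat -> R) (l : R) :
  Un_cv u l -> Un_cv (fun n => Rpower A (u n)) (Rpower A l).
Proof. apply continuity_seq, continuity_Rpower_exponent. Qed.

Lemma Un_cv_shift (u : nat -> R) (l : R) (f : nat -> nat) :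
  (forall n, (n <= f n)%nat) -> Un_cv u l -> Un_cv (fun n => u (f n)) l.
Proof.
intros Hf Hu eps e0. destruct (Hu eps e0) as [N HN]. exists N. intros n Hn. apply HN.
specialize (Hf n). lia.
Qed.

Lemma Un_cv_le (u : nat -> R) (l M : R) : Un_cv u l -> (forall n, u n <= M) -> l <= M.
Proof.
intros Hu HM. destruct (Rle_lt_dec l M) as [|lM]; trivial.
destruct (Hu (l - M)) as [N HN]; [lra|]. specialize (HN N (le_n _)). specialize (HM N).
unfold Rdist in HN. apply Rabs_def2 in HN. lra.
Qed.

Lemma tower_limit_fixed (A L : R) : Un_cv (tower A) L -> L = Rpower A L.
Proof.
intro H. apply (UL_sequence (fun n => tower A (S n))).
- now apply (Un_cv_shift _ _ S); [lia|].
- simpl. now apply Un_cv_Rpower.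
Qed.

Lemma fixed_base (A L : R) : 0 < A -> L = Rpower A L -> A = exp (ln L / L).
Proof.
intros A0 E. assert (0 < L) by (rewrite E; apply Rpower_pos).
rewrite <- (exp_ln A A0). f_equal.
assert (ln L = L * ln A) as -> by (rewrite E at 1; unfold Rpower; apply ln_exp).
field; lra.
Qed.

Lemma base_fixed (L : R) : 0 < L -> Rpower (exp (ln L / L)) L = L.
Proof.
intro L0. unfold Rpower. rewrite ln_exp. replace (L * (ln L / L)) with (ln L) by (field; lra).
now apply exp_ln.
Qed.

Lemma tower_pos (A : R) (n : nat) : 0 < A -> 0 < tower A n.
Proof. intro; destruct n; simpl; [trivial|apply Rpower_pos]. Qed.

Lemma exp1_gt1 : 1 < exp 1.
Proof. generalize (exp_ineq1 1); lra. Qed.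

Lemma exp_m1 : exp (-1) = / exp 1.
Proof. rewrite <- exp_Ropp. f_equal; ring. Qed.

(** Every term stays at most [e] since [A <= e^(1/e)]. If [L < 1/e], monotonicity of [ln x / x]
    would give [ln A = ln L / L < -e]. *)
Lemma tower_limit_range (A L : R) :
  exp (- exp 1) <= A <= exp (/ exp 1) -> Un_cv (tower A) L ->
  exp (-1) <= L <= exp 1 /\ A = exp (ln L / L).
Proof.
intros [A1 A2] H.
assert (e1 := exp1_gt1).
assert (0 < A) as A0 by (eapply Rlt_le_trans; [apply exp_pos|eassumption]).
assert (E := tower_limit_fixed _ _ H).
assert (0 < L) as L0 by (rewrite E; apply Rpower_pos).
assert (EA := fixed_base _ _ A0 E). split; trivial.
assert (L <= exp 1) as Le.
{ apply (Un_cv_le _ _ _ H). intro n. induction n as [|n IH]; simpl.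
  - eapply Rle_trans; [exact A2|]. left. apply exp_increasing.
    apply (Rmult_lt_reg_r (exp 1)); [lra|]. rewrite Rinv_l; lra.
  - unfold Rpower. assert (ln A <= / exp 1).
    { rewrite <- (ln_exp (/ exp 1)). destruct A2 as [A2| <-]; [left; now apply ln_increasing|lra]. }
    assert (tower A n * ln A <= 1).
    { apply Rle_trans with (tower A n * / exp 1).
      - apply Rmult_le_compat_l; [left; now apply tower_pos|trivial].
      - apply (Rmult_le_reg_r (exp 1)); [lra|]. rewrite Rmult_assoc, Rinv_l; lra. }
    destruct H1 as [H1| ->]; [left; now apply exp_increasing|lra]. }
split; trivial.
destruct (Rle_lt_dec (exp (-1)) L) as [|lt]; trivial. exfalso.
assert (exp (-1) <= exp 1) by (left; apply exp_increasing; lra).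
generalize (ln_div_lt _ _ L0 lt H0). rewrite ln_exp.
assert (- exp 1 <= ln L / L).
{ rewrite EA in A1. destruct (Rle_lt_dec (- exp 1) (ln L / L)) as [|X]; trivial.
  apply exp_increasing in X. lra. }
rewrite exp_m1. replace (-1 / / exp 1) with (- exp 1) by (field; lra). lra.
Qed.

Lemma mul_exp_opp_le (v : R) : v * exp (- v) <= exp (-1).
Proof.
destruct (Req_dec v 1) as [->|n]; [replace (- (1)) with (-1) by ring; lra|]. left.
assert (v < exp (v - 1)) by (generalize (exp_ineq1 (v - 1) ltac:(lra)); lra).
replace (exp (-1)) with (exp (v - 1) * exp (- v)) by (rewrite <- exp_plus; f_equal; ring).
apply Rmult_lt_compat_r; [apply exp_pos|trivial].
Qed.

Lemma mul_exp_opp_eq (v : R) : v * exp (- v) = exp (-1) -> v = 1.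
Proof.
intro E. destruct (Req_dec v 1) as [->|n]; [lra|]. exfalso.
assert (v < exp (v - 1)) by (generalize (exp_ineq1 (v - 1) ltac:(lra)); lra).
assert (v * exp (- v) < exp (v - 1) * exp (- v)) by (apply Rmult_lt_compat_r; [apply exp_pos|trivial]).
rewrite <- exp_plus in H0. replace (v - 1 + - v) with (-1) in H0 by ring. lra.
Qed.

(* The derivative of [x |-> A^(A^x)] is [c * v * exp (- v)] with [c = - ln A <= e]
   and [v = c * A^x], hence at most [1]. *)
Lemma Rpower2_fixed_unique (A L y : R) :
  exp (- exp 1) <= A < 1 -> 0 < L -> Rpower A L = L -> 0 < y ->
  Rpower A (Rpower A y) = y -> y <= L -> y = L.
Proof.
intros [A1 A2] L0 EL y0 Ey [yL|]; trivial. exfalso.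
assert (e1 := exp1_gt1).
assert (0 < A) as A0 by (eapply Rlt_le_trans; [apply exp_pos|eassumption]).
set (c := - ln A).
assert (0 < c) as c0.
{ assert (ln A < 0) by (rewrite <- ln_1; apply ln_increasing; lra). unfold c; lra. }
assert (c <= exp 1) as ce.
{ assert (- exp 1 <= ln A).
  { rewrite <- (ln_exp (- exp 1)). destruct A1 as [A1| <-]; [left; apply ln_increasing; trivial; apply exp_pos|lra]. }
  unfold c; lra. }
destruct (MVT_cor2 (fun x => Rpower A (Rpower A x))
  (fun x => Rpower A (Rpower A x) * ln A * (Rpower A x * ln A)) y L yL) as [xi [E [x1 x2]]].
{ intros x _. apply (derivable_pt_lim_comp (Rpower A) (Rpower A)); apply derivable_Rpower_exponent. }
rewrite EL, EL, Ey in E.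
set (u := Rpower A xi) in *.
assert (Rpower A u = exp (- (c * u))) as Eu by (unfold Rpower, c; f_equal; ring).
rewrite Eu in E.
assert (c * (c * u * exp (- (c * u))) = 1) as E1.
{ apply (Rmult_eq_reg_r (L - y)); [|lra]. rewrite Rmult_1_l. rewrite E at 2. unfold c; ring. }
assert (B := mul_exp_opp_le (c * u)).
assert (exp 1 * exp (-1) = 1) as Ee by (rewrite exp_m1; field; lra).
assert (0 < exp (-1)) by apply exp_pos.
(* The derivative attains its upper bound 1 at [xi], so [c = e], [c u = 1] and [xi = 1/e]. Then
   [L > 1/e], whereas [L = exp (- e L) < 1/e]. *)
assert (c = exp 1) as Ec.
{ destruct ce as [ce|]; trivial. exfalso. nra. }
assert (c * u = 1) as E2 by (apply mul_exp_opp_eq; rewrite Ec in *; nra).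
assert (u = exp (- 1)) as E3 by (rewrite Ec in E2; nra).
assert (forall z, Rpower A z = exp (- (exp 1 * z))) as P.
{ intro z. rewrite <- Ec. unfold Rpower, c. f_equal; ring. }
assert (exp 1 * xi = 1) as E4.
{ unfold u in E3. rewrite P in E3. apply exp_inv in E3. lra. }
rewrite P in EL.
assert (L < exp (-1)); [|nra].
rewrite <- EL. apply exp_increasing. nra.
Qed.

(** The tower increases and is bounded by [L]; its limit is a fixed point at most [e], hence equal
    to [L] by injectivity of [ln x / x] there. *)
Lemma tower_cv_base_ge1 (A L : R) :
  1 <= A -> 0 < L <= exp 1 -> A = exp (ln L / L) -> Un_cv (tower A) L.
Proof.
intros A1 [L0 Le] EA.
assert (EL := base_fixed L L0). rewrite <- EA in EL.
assert (forall n, tower A n <= L) as HL.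
{ intro n; induction n as [|n IH]; simpl.
  - rewrite <- EL. rewrite <- (Rpower_1 A) at 1 by lra. apply Rpower_incr; trivial.
    rewrite <- EL. rewrite <- (Rpower_O A) by lra. apply Rpower_incr; lra.
  - rewrite <- EL. now apply Rpower_incr. }
assert (Un_growing (tower A)) as G.
{ intro n; induction n as [|n IH]; simpl.
  - rewrite <- (Rpower_1 A) at 1 by lra. now apply Rpower_incr.
  - apply Rpower_incr; trivial. }
destruct (growing_cv (tower A) G) as [l Hl].
{ exists L. intros x [n ->]. apply HL. }
assert (l <= L) as lL by (apply (Un_cv_le _ _ _ Hl HL)).
assert (El := tower_limit_fixed _ _ Hl).
assert (0 < l) by (rewrite El; apply Rpower_pos).
replace L with l; trivial.
apply ln_div_inj; try lra.
apply exp_inv. rewrite <- EA. symmetry. apply fixed_base; lra.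
Qed.

(** Here [x |-> A^x] is decreasing. The terms of even index increase, bounded by [L], to a fixed
    point of [x |-> A^(A^x)], which can only be [L]; those of odd index are their images under
    [x |-> A^x]. *)
Lemma tower_cv_base_lt1 (A L : R) :
  exp (- exp 1) <= A < 1 -> 0 < L < 1 -> A = exp (ln L / L) -> Un_cv (tower A) L.
Proof.
intros [Ae A1] [L0 L1] EA.
assert (0 < A) as A0 by (eapply Rlt_le_trans; [apply exp_pos|eassumption]).
assert (EL := base_fixed L L0). rewrite <- EA in EL.
assert (forall x y, x <= y -> Rpower A (Rpower A x) <= Rpower A (Rpower A y)) as M.
{ intros x y [xy| ->]; [|lra]. left. repeat apply Rpower_decr; lra. }
assert (A < L) as AL.
{ rewrite <- EL, <- (Rpower_1 A) at 1 by lra. apply Rpower_decr; lra. }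
set (u := fun n => tower A (2 * n)).
assert (forall n, u (S n) = Rpower A (Rpower A (u n))) as Su.
{ intro n. unfold u. replace (2 * S n)%nat with (S (S (2 * n))) by lia. reflexivity. }
assert (forall n, u n <= L) as HL.
{ intro n; induction n as [|n IH]; [unfold u; simpl; lra|].
  rewrite Su. rewrite <- EL, <- EL at 1. now apply M. }
assert (Un_growing u) as G.
{ intro n; induction n as [|n IH].
  - rewrite Su. unfold u; simpl. rewrite <- (Rpower_1 A) at 1 by lra.
    left. apply Rpower_decr; [lra|]. rewrite <- (Rpower_O A) by lra. apply Rpower_decr; lra.
  - rewrite (Su n) at 1. rewrite Su. now apply M. }
destruct (growing_cv u G) as [l Hl].
{ exists L. intros x [n ->]. apply HL. }
assert (El : l = Rpower A (Rpower A l)).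
{ apply (UL_sequence (fun n => u (S n))).
  - now apply (Un_cv_shift _ _ S); [lia|].
  - intros eps e0. destruct (Un_cv_Rpower A _ _ (Un_cv_Rpower A _ _ Hl) eps e0) as [N HN].
    exists N. intros n Hn. rewrite Su. now apply HN. }
assert (0 < l) as l0 by (rewrite El; apply Rpower_pos).
assert (l = L) as E.
{ apply (Rpower2_fixed_unique A); try lra; try (split; lra). apply (Un_cv_le _ _ _ Hl HL). }
rewrite E in Hl.
assert (Hl' := Un_cv_Rpower A _ _ Hl). rewrite EL in Hl'.
intros eps e0. destruct (Hl eps e0) as [N1 H1]. destruct (Hl' eps e0) as [N2 H2].
exists (2 * (N1 + N2) + 2)%nat. intros n Hn.
destruct (Nat.Even_or_Odd n) as [[m ->]|[m ->]].
- apply (H1 m). lia.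
- replace (2 * m + 1)%nat with (S (2 * m)) by lia. apply (H2 m). lia.
Qed.

Lemma tower_cv (L : R) : exp (-1) <= L <= exp 1 ->
  exp (- exp 1) <= exp (ln L / L) <= exp (/ exp 1) /\ Un_cv (tower (exp (ln L / L))) L.
Proof.
intros [L1 L2].
assert (e1 := exp1_gt1).
assert (0 < exp (-1)) as e0 by apply exp_pos.
assert (exp (-1) < exp 1) as e2 by (apply exp_increasing; lra).
assert (exp (- exp 1) <= exp (ln L / L)) as lo.
{ replace (- exp 1) with (ln (exp (-1)) / exp (-1)).
  2:{ rewrite ln_exp, exp_m1. field; lra. }
  destruct L1 as [L1| <-]; [|lra]. left. apply exp_increasing. now apply ln_div_lt. }
split; [split; trivial|].
- replace (/ exp 1) with (ln (exp 1) / exp 1) by (rewrite ln_exp; field; lra).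
  destruct L2 as [L2| ->]; [|lra]. left. apply exp_increasing. apply ln_div_lt; lra.
- destruct (Rle_lt_dec 1 L) as [l|l].
  + apply tower_cv_base_ge1; [|lra|trivial].
    rewrite <- exp_0. assert (0 <= ln L / L) as [X| <-]; [|left; now apply exp_increasing|lra].
    apply Rle_mult_inv_pos; [|lra]. rewrite <- ln_1. destruct l as [l| <-]; [left; apply ln_increasing|]; lra.
  + apply tower_cv_base_lt1; trivial; [|lra]. split; trivial.
    rewrite <- exp_0. apply exp_increasing.
    assert (ln L < 0) by (rewrite <- ln_1; apply ln_increasing; lra).
    assert (0 < / L) by (apply Rinv_0_lt_compat; lra). unfold Rdiv; nra.
Qed.

Module RationalHeights.

Import all_boot all_order all_algebra all_fingroup boolp Rstruct.
Import mathcomp.algebra_tactics.ring mathcomp.algebra_tactics.lra mathcomp.zify.zify mathcomp.zify.ssrZ.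
Import Order.TTheory GRing.Theory Num.Theory.
Local Open Scope ring_scope.
#[local] Arguments exp : clear scopes.

(** * Zeros of exponential polynomials *)

(** Derivatives are carried as explicit functions: a sequence [G] with [is_deriv (G n) (G n.+1)]
    stands for the successive derivatives of [G 0]. *)
Definition is_deriv (f f' : R -> R) := forall x, derivable_pt_lim f x (f' x).

Lemma is_deriv_ext (f g f' g' : R -> R) :
  f =1 g -> f' =1 g' -> is_deriv f f' -> is_deriv g g'.
Proof.
move=> fg fg' H x eps e0; rewrite -fg'; have [d Hd] := H x eps e0.
by exists d => h h0 hd; rewrite -!fg; apply: Hd.
Qed.

Lemma is_derivD (f g f' g' : R -> R) : is_deriv f f' -> is_deriv g g' ->
  is_deriv (fun x => f x + g x) (fun x => f' x + g' x).
Proof. by move=> H1 H2 x; apply: derivable_pt_lim_plus. Qed.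

Lemma is_derivM (f g f' g' : R -> R) : is_deriv f f' -> is_deriv g g' ->
  is_deriv (fun x => f x * g x) (fun x => f' x * g x + f x * g' x).
Proof. by move=> H1 H2 x; apply: derivable_pt_lim_mult. Qed.

Lemma is_deriv_id : is_deriv (fun x => x) (fun=> 1).
Proof. exact: derivable_pt_lim_id. Qed.

Lemma is_deriv_cst (c : R) : is_deriv (fun=> c) (fun=> 0).
Proof. by move=> x; apply: derivable_pt_lim_const. Qed.

Lemma is_derivZ (c : R) (f f' : R -> R) : is_deriv f f' ->
  is_deriv (fun x => c * f x) (fun x => c * f' x).
Proof. by move=> H x; apply: derivable_pt_lim_scal. Qed.

Lemma is_deriv_sum (I : Type) (r : seq I) (f f' : I -> R -> R) :
  (forall i, is_deriv (f i) (f' i)) ->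
  is_deriv (fun x => \sum_(i <- r) f i x) (fun x => \sum_(i <- r) f' i x).
Proof.
move=> H; elim: r => [|i r IH].
  by apply: is_deriv_ext (is_deriv_cst 0) => x; rewrite big_nil.
by apply: is_deriv_ext (is_derivD _ _ _ _ (H i) IH) => x; rewrite big_cons.
Qed.

Lemma is_deriv_horner (p : {poly R}) : is_deriv (horner p) (horner p^`()).
Proof.
elim/poly_ind: p => [|p c IH].
  by apply: is_deriv_ext (is_deriv_cst 0) => x; rewrite ?deriv0 horner0.
have := is_derivD _ _ _ _ (is_derivM _ _ _ _ IH is_deriv_id) (is_deriv_cst c).
apply: is_deriv_ext => x.
  by rewrite hornerMXaddC.
by rewrite derivMXaddC hornerD hornerMX mulr1 addr0 addrC.
Qed.

Lemma is_deriv_exp (w : R) : is_deriv (fun x => exp (w * x)) (fun x => w * exp (w * x)).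
Proof.
move=> x; rewrite mulrC.
have H : is_deriv (fun x => w * x) (fun=> w).
  have := is_derivZ w _ _ is_deriv_id.
  by apply: is_deriv_ext => y; rewrite ?mulr1.
exact: (derivable_pt_lim_comp _ exp x _ _ (H x) (derivable_pt_lim_exp _)).
Qed.

Definition exp_poly (w : R) (p : {poly R}) (x : R) := p.[x] * exp (w * x).

Definition exp_deriv (w : R) (p : {poly R}) := p^`() + w *: p.

Lemma is_deriv_exp_poly (w : R) (p : {poly R}) :
  is_deriv (exp_poly w p) (exp_poly w (exp_deriv w p)).
Proof.
have := is_derivM _ _ _ _ (is_deriv_horner p) (is_deriv_exp w).
apply: is_deriv_ext => x //.
by rewrite /exp_poly /exp_deriv hornerD hornerZ; ring.
Qed.

Lemma rolle (f f' : R -> R) (a b : R) : is_deriv f f' -> a < b -> f a = f b ->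
  exists2 c, a < c < b & f' c = 0.
Proof.
move=> H ab fab.
have [c [E [/RltP ac /RltP cb]]] := MVT_cor2 f f' a b (elimT RltP ab) (fun c _ => H c).
exists c; first by rewrite ac.
move: E; rewrite fab RminusE subrr RmultE RminusE => /esym/eqP.
by rewrite mulf_eq0 subr_eq0 (gt_eqF ab) orbF => /eqP.
Qed.

Lemma rolle_path (f f' : R -> R) (a b x : R) (z : seq R) : is_deriv f f' ->
  path <%R x z -> {in x :: z, forall y, f y = 0 /\ a <= y <= b} ->
  exists z', [/\ size z' = size z, path <%R x z' &
    {in z', forall y, f' y = 0 /\ a <= y <= b}].
Proof.
move=> H; elim: z x => [|y z IH] x /=; first by move=> _ _; exists [::].
case/andP=> xy yz Hz.
have [|z' [sz pz Hz']] := IH y yz; first by move=> t tz; apply: Hz; rewrite inE tz orbT.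
have [x0 /andP[ax _]] := Hz x (mem_head _ _).
have [|y0 /andP[_ yb]] := Hz y; first by rewrite !inE eqxx orbT.
have [|c /andP[xc cy] fc] := rolle f f' x y H xy; first by rewrite x0 y0.
exists (c :: z'); split=> /=; first by rewrite sz.
  rewrite xc /=; exact: (path_le lt_trans cy).
move=> t; rewrite inE => /predU1P[-> | /Hz' //]; split=> //.
by rewrite (le_trans ax (ltW xc)) (le_trans (ltW cy) yb).
Qed.

Lemma rolle_uniq (f f' : R -> R) (a b : R) (z : seq R) : is_deriv f f' ->
  uniq z -> {in z, forall y, f y = 0 /\ a <= y <= b} ->
  exists z', [/\ size z' = (size z).-1, uniq z' &
    {in z', forall y, f' y = 0 /\ a <= y <= b}].
Proof.
move=> H; rewrite -sort_lt_sorted -(size_sort <=%R) => sz Hz.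
have {}Hz : {in sort <=%R z, forall y, f y = 0 /\ a <= y <= b}.
  by move=> y; rewrite mem_sort; apply: Hz.
case: (sort _ _) sz Hz => [|x s] /= sz Hz; first by exists [::].
have [z' [E pz Hz']] := rolle_path f f' a b x s H sz Hz.
exists z'; split=> //; apply: (sorted_uniq lt_trans ltxx).
exact: (path_sorted pz).
Qed.

Lemma rolle_iter (G : nat -> R -> R) (a b : R) (z : seq R) :
  (forall n, is_deriv (G n) (G n.+1)) -> uniq z -> (0 < size z)%N ->
  {in z, forall y, G 0%N y = 0 /\ a <= y <= b} ->
  exists2 xi, a <= xi <= b & G (size z).-1 xi = 0.
Proof.
move=> H; case E: (size z) => [//|n] uz _ Hz.
suff: forall m, (m <= n)%N -> exists z', [/\ size z' = (n - m).+1, uniq z' &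
    {in z', forall y, G m y = 0 /\ a <= y <= b}].
  move/(_ n (leqnn n)) => [[|y s] [//= _ _ /(_ y (mem_head _ _)) [? ?]]].
  by exists y.
elim=> [|m IH] mn; first by exists z; rewrite subn0.
have [z' [sz' uz' Hz']] := IH (ltnW mn).
have [z2 [sz2 uz2 Hz2]] := rolle_uniq _ _ a b z' (H m) uz' Hz'.
by exists z2; split=> //; rewrite sz2 sz' /=; lia.
Qed.

Lemma derivn_monic (n : nat) (p : {poly R}) : p \is monic -> size p = n.+1 ->
  p^`(n) = (n`!%:R)%:P.
Proof.
move=> pm sp; have s1 : (size p^`(n) <= 1)%N.
  apply/leq_sizeP => j j1; rewrite coef_derivn nth_default ?mul0rn // sp.
  lia.
rewrite (size1_polyC s1) coef_derivn addn0 ffactnn.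
by have := monicP pm; rewrite /lead_coef sp /= => ->.
Qed.

(* The remainder of Lagrange interpolation at the zeros [z] of [G 0]. *)
Lemma interpolation_remainder (G : nat -> R -> R) (a b x : R) (z : seq R) :
  (forall n, is_deriv (G n) (G n.+1)) -> uniq z ->
  {in z, forall y, G 0%N y = 0 /\ a <= y <= b} -> a <= x <= b ->
  exists2 xi, a <= xi <= b &
    G 0%N x * (size z)`!%:R = G (size z) xi * \prod_(t <- z) (x - t).
Proof.
move=> H uz Hz xab; have [xz|xz] := boolP (x \in z).
  exists x => //; rewrite (Hz x xz).1 mul0r (big_rem x xz) /= subrr.
  by rewrite mul0r mulr0.
pose W := \prod_(t <- z) ('X - t%:P).
have Wx y : W.[y] = \prod_(t <- z) (y - t).
  by rewrite horner_prod; apply: eq_bigr => t _; rewrite hornerXsubC.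
(* [F 0] vanishes at [x] as well as on [z], so [F (size z)] has a zero; at that order [W]
   contributes only the constant [(size z)!]. *)
pose F n y := W.[x] * G n y - G 0%N x * W^`(n).[y].
have FH n : is_deriv (F n) (F n.+1).
  have := is_derivD _ _ _ _ (is_derivZ W.[x] _ _ (H n))
    (is_derivZ (- G 0%N x) _ _ (is_deriv_horner W^`(n))).
  by apply: is_deriv_ext => y; rewrite /F ?derivnS mulNr.
have [||| xi xiab] := rolle_iter F a b (x :: z) FH => //=.
- by rewrite xz.
- move=> y; rewrite inE /F derivn0 => /predU1P[-> | yz]; first by rewrite mulrC subrr.
  have [Gy yab] := Hz y yz; rewrite Gy mulr0 sub0r (_ : W.[y] = 0) ?mulr0 ?oppr0 //.
  by rewrite Wx (big_rem y yz) /= subrr mul0r.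
rewrite /F (derivn_monic (size z)) ?monic_prod_XsubC ?size_prod_XsubC //.
rewrite hornerC => /eqP; rewrite subr_eq0 => /eqP E.
by exists xi => //; rewrite -E Wx mulrC.
Qed.

Lemma size_exp_deriv (w : R) (p : {poly R}) : w != 0 -> size (exp_deriv w p) = size p.
Proof.
move=> w0; rewrite /exp_deriv; have [->|p0] := eqVneq p 0.
  by rewrite deriv0 scaler0 addr0.
by rewrite addrC size_polyDl size_scale // lt_size_deriv.
Qed.

(** Induction on the total size of the coefficients. Division by [exp (w j0 * y)] keeps the zeros;
    differentiation then lowers the size of [p j0], keeps the other sizes, and costs one zero by
    Rolle. So all [p' j] vanish, which leaves a single term with constant coefficient, and this has
    no zero. *)
Lemma exp_poly_zeros (n : nat) (w : 'I_n -> R) (p : 'I_n -> {poly R}) (z : seq R) :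
  injective w -> uniq z -> (\sum_j size (p j) <= size z)%N ->
  {in z, forall y, \sum_j exp_poly (w j) (p j) y = 0} ->
  forall j, p j = 0.
Proof.
have [T] := ubnP (\sum_j size (p j))%N.
elim: T w p z => // T IH w p z leT wi uz sz Hz.
have [/existsP[j0 pj0]|] := boolP [exists j, p j != 0]; last first.
  by rewrite negb_exists => /forallP H j; apply/eqP; have := H j; rewrite negbK.
pose w' j := w j - w j0; pose p' j := exp_deriv (w' j) (p j).
have w'i : injective w' by move=> i j /addIr /wi.
have w'0 j : j != j0 -> w' j != 0.
  by apply: contra => /eqP; rewrite -(subrr (w j0)) => /addIr /wi ->.
have sp' j : j != j0 -> size (p' j) = size (p j) by move=> /w'0 /size_exp_deriv ->.
have p'j0 : p' j0 = (p j0)^`() by rewrite /p' /exp_deriv /w' subrr scale0r addr0.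
have lts : (\sum_j size (p' j) < \sum_j size (p j))%N.
  rewrite (bigD1 j0) //= [X in (_ < X)%N](bigD1 j0) //= p'j0.
  rewrite (eq_bigr (fun j => size (p j))) => [|j /sp' -> //].
  by rewrite ltn_add2r lt_size_deriv.
have Fw' y : \sum_j exp_poly (w' j) (p j) y = exp (- w j0 * y) * \sum_j exp_poly (w j) (p j) y.
  rewrite mulr_sumr; apply: eq_bigr => j _; rewrite /exp_poly.
  have -> : w' j * y = - w j0 * y + w j * y by rewrite /w'; ring.
  by rewrite -expRD; ring.
pose M := \sum_(y <- z) `|y|.
have zM y : y \in z -> - M <= y <= M.
  move=> yz; rewrite -ler_norml /M (big_rem y yz) /= lerDl; exact: sumr_ge0.
have [||z' [sz' uz' Hz']] := rolle_uniq (fun x => \sum_j exp_poly (w' j) (p j) x)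
  (fun x => \sum_j exp_poly (w' j) (p' j) x) (- M) M z _ uz.
- by apply: is_deriv_sum => j; apply: is_deriv_exp_poly.
- by move=> y yz; rewrite Fw' Hz // mulr0; split=> //; apply: zM.
have p'0 : forall j, p' j = 0.
  apply: (IH w' p' z') => //; first exact: leq_trans lts _.
    by rewrite sz'; lia.
  by move=> y /Hz' [].
have pj j : j != j0 -> p j = 0.
  by move=> jj; apply/eqP; rewrite -size_poly_eq0 -sp' // p'0 size_poly0.
have sp0 : size (p j0) = 1%N.
  apply/eqP; rewrite eqn_leq size_poly_gt0 pj0 andbT.
  apply/leq_sizeP => -[//|j] _; have := congr1 (fun q : {poly R} => q`_j) (p'0 j0).
  by rewrite p'j0 coef_deriv coef0 => /eqP; rewrite mulrn_eq0 => /eqP.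
have [c c0 pc] := size_poly1P _ (introT eqP sp0).
have: z != [::].
  apply: contraL (leq_trans lts sz) => /eqP ->; by rewrite -leqNgt.
case: z {sz uz sz' zM M Hz' } Hz => // y z Hz _.
have := Hz y (mem_head _ _).
rewrite (bigD1 j0) //= big1 => [|j jj]; last by rewrite /exp_poly pj // horner0 mul0r.
rewrite addr0 /exp_poly pc hornerC => /eqP; rewrite mulf_eq0 (negbTE c0) /= => /eqP E.
by have /RltP := exp_pos (w j0 * y); rewrite E ltxx.
Qed.

(** * Upper bound for interpolation determinants *)

(** Rows are treated from the last to the first. As a function of the point in row [k], the
    determinant vanishes at the earlier points, where two rows agree; the interpolation remainder
    thus replaces row [k] by derivatives of order [k], at the cost of
    [\prod_(l < k) (x k - x l) / k!]. *)
Lemma det_interpolation (N : nat) (g : 'I_N -> nat -> R -> R) (a b : R) (x : 'I_N -> R) :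
  (forall i n, is_deriv (g i n) (g i n.+1)) -> injective x ->
  (forall p, a <= x p <= b) ->
  exists2 xi : 'I_N -> R, (forall p, a <= xi p <= b) &
    \det (\matrix_(p, i) g i 0%N (x p)) * \prod_(p < N) (p`!)%:R =
    \det (\matrix_(p, i) g i p (xi p)) * \prod_(p < N) \prod_(l < N | (l < p)%N) (x p - x l).
Proof.
move=> H xinj xab; pose D0 := \det (\matrix_(p, i) g i 0%N (x p)).
suff: forall m, (m <= N)%N -> exists2 xi : 'I_N -> R, (forall p, a <= xi p <= b) &
    D0 * \prod_(p < N | (N - m <= p)%N) (p`!)%:R =
    \det (\matrix_(p, i) if (p < N - m)%N then g i 0%N (x p) else g i p (xi p)) *
    \prod_(p < N | (N - m <= p)%N) \prod_(l < N | (l < p)%N) (x p - x l).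
  move/(_ N (leqnn N)) => [xi Hxi E]; exists xi => //; move: E.
  rewrite subnn (eq_bigl xpredT) // => ->; congr (\det _ * _).
elim=> [|m IH] mN.
  exists x => //; rewrite !big_pred0 => [|p|p]; try by rewrite subn0 leqNgt ltn_ord.
  rewrite !mulr1; congr (\det _); apply/matrixP => p i; rewrite !mxE.
  by rewrite subn0 ltn_ord.
have [xi Hxi E] := IH (ltnW mN).
have kN : (N - m.+1 < N)%N by lia.
pose k := Ordinal kN.
have Nm : (N - m = k.+1)%N by rewrite /=; lia.
rewrite Nm in E; rewrite -[(N - m.+1)%N]/(nat_of_ord k).
pose r (p : 'I_N) i := if (p < k.+1)%N then g i 0%N (x p) else g i p (xi p).
(* Only row [k] depends on [y]; expansion along it, with the constant cofactors [c i], shows that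
   [\det (M n y)] is the derivative of order [n] of [\det (M 0 y)]. *)
pose M n y := \matrix_(p, i) if p == k then g i n y else r p i.
pose c i := cofactor (\matrix_(p, i) r p i) k i.
have MG n y : \det (M n y) = \sum_i c i * g i n y.
  rewrite (expand_det_row _ k); apply: eq_bigr => i _; rewrite mxE eqxx mulrC.
  congr (_ * _); rewrite /c /cofactor; congr (_ * \det _); apply/matrixP => p j.
  by rewrite !mxE eq_sym (negbTE (neq_lift _ _)).
have MH n : is_deriv (fun y => \det (M n y)) (fun y => \det (M n.+1 y)).
  have := is_deriv_sum _ (index_enum 'I_N) _ _ (fun i => is_derivZ (c i) _ _ (H i n)).
  by apply: is_deriv_ext => y; rewrite MG.
pose z := [seq x l | l <- [seq l : 'I_N <- enum 'I_N | (l < k)%N]].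
have uz : uniq z by rewrite map_inj_uniq // filter_uniq // enum_uniq.
have sz : size z = k.
  rewrite size_map -sum1_size big_filter big_enum_cond /=.
  by rewrite -(big_ord_widen N (fun=> 1%N) (ltnW kN)) sum1_card card_ord.
have [||eta etaab] := interpolation_remainder (fun n y => \det (M n y)) a b (x k) z MH uz.
- move=> y /mapP[l]; rewrite mem_filter => /andP[lk _] ->; split => //.
  have kl : k != l by apply: contraTneq lk => ->; rewrite ltnn.
  apply: (determinant_alternate kl) => i; rewrite !mxE eqxx eq_sym (negbTE kl) /r.
  by rewrite ltnS ltnW.
- exact: xab.
rewrite sz => E2.
have xk : \det (M 0%N (x k)) = \det (\matrix_(p, i) r p i).
  congr (\det _); apply/matrixP => p i; rewrite !mxE; case: eqP => // ->.
  by rewrite /r ltnS leqnn.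
exists (fun p => if p == k then eta else xi p).
  by move=> p; case: eqP.
rewrite (bigD1 k) //= [X in _ = _ * X](bigD1 k) //=.
have Ep F : \prod_(p < N | (k <= p)%N && (p != k)) F p = \prod_(p < N | (k.+1 <= p)%N) F p :> R.
  by apply: eq_bigl => p; rewrite ltn_neqAle andbC eq_sym.
rewrite !Ep mulrCA E -/(r) -xk mulrA [_ * \det _]mulrC E2 mulrA; congr (_ * _ * _).
  congr (\det _); apply/matrixP => p i; rewrite !mxE /r.
  case: (eqVneq p k) => [->|pk]; first by rewrite ltnn.
  have -> : (p < k.+1)%N = (p < k)%N by rewrite ltnS leq_eqVlt (inj_eq val_inj) (negbTE pk).
  by [].
by rewrite big_map big_filter big_enum_cond.
Qed.

Lemma det_norm_le (F : numDomainType) (N : nat) (M : 'M[F]_N) (B : 'I_N -> F) :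
  (forall p i, `|M p i| <= B p) -> `|\det M| <= N`!%:R * \prod_p B p.
Proof.
move=> H; apply: (le_trans (ler_norm_sum _ _ _)).
rewrite (_ : _ * _ = \sum_(s : 'S_N) \prod_p B p).
  apply: ler_sum => s _; rewrite normrM normrX normrN1 expr1n mul1r normr_prod.
  by apply: ler_prod => p _; rewrite normr_ge0 H.
by rewrite sumr_const card_Sn mulr_natl.
Qed.

Lemma is_derivX (n : nat) :
  is_deriv (fun t => t ^+ n.+1) (fun t => n.+1%:R * t ^+ n).
Proof.
elim: n => [|n IH].
  by apply: is_deriv_ext is_deriv_id => t; rewrite ?expr1 ?mulr1.
apply: is_deriv_ext (is_derivM _ _ _ _ is_deriv_id IH) => t.
  by rewrite -exprS.
by rewrite mul1r mulrCA -exprS -[n.+2]addn1 natrD mulrDl mul1r addrC.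
Qed.

(** A single term of the exponential series is at most its sum; the induction on [p] compares
    derivatives. Taking the product over [p < N] bounds the factorials of [det_interpolation] from
    below without Stirling's formula. *)
Lemma natX_le_exp_fact (N p : nat) : N%:R ^+ p <= exp N%:R * p`!%:R.
Proof.
have e0 y : 0 < exp y by apply/RltP/exp_pos.
suff: forall y : R, 0 <= y -> y ^+ p <= exp y * p`!%:R by apply; apply: ler0n.
elim: p => [|p IH] y y0.
  rewrite expr0 mulr1 -expR0; case: (eqVneq y 0) => [-> //|yn0].
  by apply/ltW/RltP/exp_increasing/RltP; rewrite lt_def yn0.
pose F (t : R) := exp t * p.+1`!%:R - t ^+ p.+1.
pose F' (t : R) := exp t * p.+1`!%:R - p.+1%:R * t ^+ p.
have FD : is_deriv F F'.
  have := is_derivD _ _ _ _ (is_derivZ p.+1`!%:R _ _ (is_deriv_exp 1))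
    (is_derivZ (-1) _ _ (is_derivX p)).
  by apply: is_deriv_ext => t; rewrite mulN1r !mul1r mulrC.
rewrite -subr_ge0 -/(F y); case: (eqVneq y 0) => [->|yn0].
  by rewrite /F expr0n subr0 mulr_ge0 // ltW.
have yp : 0 < y by rewrite lt_def yn0.
have [c [E [/RltP ac /RltP cb]]] := MVT_cor2 F F' 0 y (elimT RltP yp) (fun c _ => FD c).
rewrite -[F y](subrK (F 0)) addr_ge0 //; last by rewrite /F expr0n subr0 mulr_ge0 // ltW.
move: E; rewrite !RminusE => ->; rewrite subr0 RmultE mulr_ge0 //.
rewrite /F' factS natrM mulrCA -mulrBr mulr_ge0 // subr_ge0.
exact: IH (ltW ac).
Qed.

(** Row [p] contributes [B c^p] and at most [(b - a)^p] from the differences; the exponents [p < N]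
    add up to ['C(N, 2)]. *)
Lemma det_interpolation_bound (N : nat) (g : 'I_N -> nat -> R -> R) (a b B c : R) (x : 'I_N -> R) :
  (forall i n, is_deriv (g i n) (g i n.+1)) -> injective x ->
  (forall p, a <= x p <= b) ->
  (forall i n y, a <= y <= b -> `|g i n y| <= B * c ^+ n) -> 0 <= B -> 0 <= c ->
  `|\det (\matrix_(p, i) g i 0%N (x p))| * N%:R ^+ 'C(N, 2) <=
  N`!%:R * (exp N%:R * B) ^+ N * (c * (b - a)) ^+ 'C(N, 2).
Proof.
move=> H xinj xab gB B0 c0.
have e0 y : 0 < exp y by apply/RltP/exp_pos.
have [xi Hxi /(congr1 Num.norm)] := det_interpolation N g a b x H xinj xab.
rewrite !normrM => E.
have pw (q : R) : q ^+ 'C(N, 2) = \prod_(p < N) q ^+ p.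
  by rewrite -bin2_sum big_mkord expr_sum.
have cst (q : R) : q ^+ N = \prod_(p < N) q by rewrite prodr_const card_ord.
have L1 : N%:R ^+ 'C(N, 2) <= exp N%:R ^+ N * \prod_(p < N) (p`!)%:R.
  rewrite pw cst -big_split /=; apply: ler_prod => p _.
  by rewrite exprn_ge0 ?ler0n //= natX_le_exp_fact.
apply: (le_trans (ler_wpM2l (normr_ge0 _) L1)).
rewrite mulrCA -[\prod_(p < N) _]ger0_norm; last by apply: prodr_ge0 => p _; apply: ler0n.
rewrite E; have -> : N`!%:R * (exp N%:R * B) ^+ N * (c * (b - a)) ^+ 'C(N, 2)
   = exp N%:R ^+ N * ((N`!%:R * \prod_(p < N) (B * c ^+ p)) * \prod_(p < N) (b - a) ^+ p).
  rewrite !exprMn !pw big_split /= -cst; ring.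
rewrite ler_wpM2l //; first by rewrite exprn_ge0 // ltW.
apply: ler_pM => //.
  by apply: det_norm_le => p i; rewrite mxE; apply: gB.
rewrite normr_prod; apply: ler_prod => p _; rewrite normr_ge0 normr_prod /=.
apply: (@le_trans _ _ (\prod_(l < N | (l < p)%N) (b - a))).
  apply: ler_prod => l _; rewrite normr_ge0 ler_norml.
  by have := xab p; have := xab l; lra.
by rewrite -(big_ord_widen N (fun=> b - a) (ltnW (ltn_ord p))) prodr_const card_ord.
Qed.

(** * Liouville inequality *)

Definition int_eval (Q : {poly int}) (x : R) : R := (map_poly intr Q).[x].

Lemma int_evalM (x : R) (P Q : {poly int}) : int_eval (P * Q) x = int_eval P x * int_eval Q x.
Proof. by rewrite /int_eval rmorphM hornerM. Qed.

Lemma int_evalD (x : R) (P Q : {poly int}) : int_eval (P + Q) x = int_eval P x + int_eval Q x.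
Proof. by rewrite /int_eval rmorphD hornerD. Qed.

Lemma int_evalC (x : R) (c : int) : int_eval c%:P x = c%:~R.
Proof. by rewrite /int_eval map_polyC hornerC. Qed.

Lemma int_evalX (x : R) : int_eval 'X x = x.
Proof. by rewrite /int_eval map_polyX hornerX. Qed.

Lemma int_evalXn (x : R) (P : {poly int}) (n : nat) : int_eval (P ^+ n) x = int_eval P x ^+ n.
Proof. by rewrite /int_eval rmorphXn horner_exp. Qed.

Lemma int_evalE (x : R) (P : {poly int}) (n : nat) : (size P <= n)%N ->
  int_eval P x = \sum_(i < n) (P`_i)%:~R * x ^+ i.
Proof.
move=> sP; rewrite /int_eval (@horner_coef_wide _ n).
  by apply: eq_bigr => i _; rewrite coef_map.
exact: leq_trans (size_poly _ _) sP.
Qed.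

Lemma det_int_eval (x : R) (n : nat) (M : 'M[{poly int}]_n) :
  int_eval (\det M) x = \det (\matrix_(i, j) int_eval (M i j) x).
Proof.
rewrite /int_eval -det_map_mx -[_.[x]]/(horner_eval x _) -det_map_mx; congr (\det _).
by apply/matrixP => i j; rewrite !mxE.
Qed.

Lemma IZR_intr (z : Z) : IZR z = (int_of_Z z)%:~R.
Proof.
case: z => [|p|p] //=; rewrite /IZR ?NegzE -INR_IPR INRE //.
by rewrite prednK ?mulrNz //; lia.
Qed.

Lemma is_algebraic_int_eval (x : R) :
  is_algebraic x -> exists2 P : {poly int}, P != 0 & int_eval P x = 0.
Proof.
case=> l [[c [cl c0]] lx]; exists (Poly (map int_of_Z l)).
  apply/eqP => E.
  have H i : nth 0 (map int_of_Z l) i = 0 by rewrite -coef_Poly E coef0.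
  have [i [il ic]] := List.In_nth l c Z0 cl.
  have := H i; have {}il : (i < size l)%N by apply/ssrnat.ltP.
  rewrite (nth_map Z0) // => Ei; apply: c0.
  have -> : c = nth Z0 l i.
    by rewrite -ic; elim: (l) (i) => [|? ? IH] [|?] //=.
  by rewrite -[LHS]int_of_ZK Ei.
apply: etrans lx; rewrite /int_eval {cl c0 c}.
elim: l => [|c l IH] /=; first by rewrite rmorph0 horner0.
rewrite cons_poly_def rmorphD rmorphM /= map_polyC map_polyX hornerD hornerM IH.
by rewrite hornerX hornerC IZR_intr addrC mulrC.
Qed.

Lemma min_int_eval (x : R) : is_algebraic x ->
  exists P : {poly int}, [/\ P != 0, int_eval P x = 0 &
    forall Q : {poly int}, (size Q < size P)%N -> int_eval Q x = 0 -> Q = 0].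
Proof.
move/is_algebraic_int_eval => [P].
have [n] := ubnP (size P); elim: n P => // n IH P sP P0 Px.
have [[Q [sQ Q0 Qx]]|H] := Classical_Prop.classic
  (exists Q : {poly int}, [/\ (size Q < size P)%N, Q != 0 & int_eval Q x = 0]).
  by apply: IH Q0 Qx; apply: leq_trans sQ _.
exists P; split=> // Q sQ Qx; apply/eqP/negP => Q0; apply: H.
by exists Q; split=> //; apply/negP.
Qed.

(** The sum of the entries rather than their maximum, because it is submultiplicative. *)
Definition mx_norm1 (n : nat) (A : 'M[int]_n) : int := \sum_i \sum_j `|A i j|.

Lemma mx_norm1_ge0 (n : nat) (A : 'M[int]_n) : 0 <= mx_norm1 n A.
Proof. by do 2![apply: sumr_ge0 => ? _]. Qed.

Lemma mx_norm1D (n : nat) (A B : 'M[int]_n) : mx_norm1 n (A + B) <= mx_norm1 n A + mx_norm1 n B.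
Proof.
rewrite -big_split; apply: ler_sum => i _; rewrite -big_split; apply: ler_sum => j _ /=.
by rewrite mxE ler_normD.
Qed.

Lemma mx_norm1M (n : nat) (A B : 'M[int]_n) : mx_norm1 n (A *m B) <= mx_norm1 n A * mx_norm1 n B.
Proof.
rewrite mulr_suml; apply: ler_sum => i _; rewrite mulr_suml.
apply: (@le_trans _ _ (\sum_j \sum_k `|A i k| * `|B k j|)).
  apply: ler_sum => j _; rewrite mxE; apply: (le_trans (ler_norm_sum _ _ _)).
  by apply: ler_sum => k _; rewrite normrM.
rewrite exchange_big; apply: ler_sum => k _ /=; rewrite -mulr_sumr.
apply: ler_wpM2l => //; rewrite [leRHS](bigD1 k) //= lerDl.
by apply: sumr_ge0 => l _; apply: sumr_ge0.
Qed.

Lemma mx_norm1_entry (n : nat) (A : 'M[int]_n) (i j : 'I_n) : `|A i j| <= mx_norm1 n A.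
Proof.
rewrite /mx_norm1 (bigD1 i) //= (bigD1 j) //= -addrA lerDl addr_ge0 ?sumr_ge0 //.
by move=> k _; apply: sumr_ge0.
Qed.

Lemma mx_norm1_scalar (n : nat) (c : int) : mx_norm1 n (c%:M) = n%:R * `|c|.
Proof.
rewrite /mx_norm1 (eq_bigr (fun=> `|c|)) => [|i _].
  by rewrite sumr_const card_ord mulr_natl.
rewrite (bigD1 i) //= big1 => [|j ji]; first by rewrite mxE eqxx addr0.
by rewrite mxE eq_sym (negbTE ji) normr0.
Qed.

(* Multiplication by [b L] on the lattice spanned by [1, L, ..., L^d] has an integer
   matrix [C] when [b] is the leading coefficient of a minimal integer polynomial of [L];
   [nu Q] is the size of [Q(C)], whose determinant is a nonzero integer when
   [Q(b L) <> 0]. *)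
Lemma liouville (L : R) : is_algebraic L ->
  exists (b : int) (d : nat) (K : R) (nu : {poly int} -> R),
  [/\ b != 0, forall Q, 0 <= nu Q,
      forall P Q, nu (P + Q) <= nu P + nu Q /\ nu (P * Q) <= nu P * nu Q,
      forall c : int, nu c%:P <= d.+1%:R * `|c%:~R| &
      forall Q, int_eval Q (b%:~R * L) != 0 ->
        1 <= `|int_eval Q (b%:~R * L)| * (K * nu Q ^+ d)].
Proof.
move=> /min_int_eval[P [P0 PL Pmin]].
have [d sP] : exists d, size P = d.+2.
  case sP: (size P) => [|[|d]]; last by exists d.
    by move/eqP: sP; rewrite size_poly_eq0 (negbTE P0).
  have [c c0 Pc] := size_poly1P _ (introT eqP sP).
  by move/eqP: PL; rewrite Pc int_evalC intr_eq0 (negbTE c0).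
pose b := P`_d.+1.
have b0 : b != 0 by move: P0; rewrite -lead_coef_eq0 /lead_coef sP.
pose v : 'cV[R]_d.+1 := \col_i L ^+ i.
(* A companion matrix scaled by [b]: [b L * L^i = b L^(i+1)] for [i < d], and [P(L) = 0] rewrites
   [b L * L^d] as [- \sum_j P_j L^j]. *)
pose C : 'M[int]_d.+1 := \matrix_(i, j)
  if (i < d)%N then (if (j == i.+1 :> nat) then b else 0) else - P`_j.
pose toR (A : 'M[int]_d.+1) : 'M[R]_d.+1 := map_mx intr A.
have Cv : toR C *m v = (b%:~R * L) *: v.
  apply/colP => i; rewrite !mxE; case: (ltnP i d) => id.
    have i1 : (i.+1 < d.+1)%N by [].
    rewrite (bigD1 (Ordinal i1)) //= !mxE /= id eqxx big1 ?addr0 => [|j ji].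
      by rewrite exprS mulrA.
    by rewrite !mxE id; case: eqP => [e|]; rewrite ?mul0r //; case/eqP: ji; apply: val_inj.
  have {id} -> : i = ord_max by apply: val_inj => /=; apply/eqP; rewrite eqn_leq -ltnS ltn_ord.
  move: PL; rewrite (int_evalE _ _ d.+2) ?sP // big_ord_recr /= => /eqP.
  rewrite addrC addr_eq0 -/b exprS mulrA => /eqP ->; rewrite -sumrN.
  by apply: eq_bigr => j _; rewrite !mxE ltnn mulrNz mulNr.
have Qv Q : toR (horner_mx C Q) *m v = int_eval Q (b%:~R * L) *: v.
  elim/poly_ind: Q => [|Q c IH].
    by rewrite rmorph0 /toR map_mx0 mul0mx /int_eval rmorph0 horner0 scale0r.
  rewrite rmorphD rmorphM /= horner_mx_X horner_mx_C /toR map_mxD map_mxM map_scalar_mx.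
  rewrite mulmxDl -mulmxA Cv -scalemxAr IH mul_scalar_mx scalerA -scalerDl.
  by rewrite int_evalD int_evalM int_evalX int_evalC mulrC.
exists b, d, (d`!%:R * \sum_j `|v j 0|), (fun Q => (mx_norm1 _ (horner_mx C Q))%:~R).
split=> //.
- by move=> Q; rewrite ler0z mx_norm1_ge0.
- move=> P' Q; rewrite (rmorphD (horner_mx C)) (rmorphM (horner_mx C)).
  by rewrite -intrD -intrM !ler_int; split; [apply: mx_norm1D|apply: mx_norm1M].
- by move=> c; rewrite horner_mx_C mx_norm1_scalar rmorphM /= intr_norm // mulrz_nat.
move=> Q Q0; set A := horner_mx C Q.
have dA : \det A != 0.
  (* Since [Q(b L)] is nonzero, a kernel vector of [A] would give a nonzero integer polynomial [W]
     of degree at most [d] with [W(L) = 0], against minimality. *)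
  apply/negP => /det0P[w w0 wA].
  pose W := \poly_(i < d.+1) w 0 (inord i).
  have WL : int_eval W L = (map_mx intr w *m v) 0 0.
    rewrite (int_evalE _ _ d.+1) ?size_poly // mxE; apply: eq_bigr => j _.
    by rewrite coef_poly ltn_ord inord_val !mxE.
  have : map_mx intr w *m (toR A *m v) = 0.
    by rewrite mulmxA /toR -map_mxM wA map_mx0 mul0mx.
  rewrite Qv -scalemxAr => /matrixP/(_ 0 0)/eqP.
  rewrite mxE -WL [X in _ == X]mxE mulf_eq0 (negbTE Q0) => /eqP.
  move=> WL0; have W0 : W = 0 by apply: Pmin; rewrite ?sP ?ltnS ?size_poly.
  case/negP: w0; apply/eqP/rowP => j; have := congr1 (fun q : {poly int} => q`_j) W0.
  by rewrite /W coef_poly ltn_ord inord_val coef0 mxE.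
(* Applied to [v], the first coordinate writes the nonzero integer [\det A] as [Q(b L)] times a
   combination of the [L^j] whose coefficients are cofactors, each at most [d! * nu Q ^ d]. *)
have: (\adj A *m A) = (\det A)%:M by exact: mul_adj_mx.
move/(congr1 (fun X => toR X *m v)); rewrite /toR map_mxM -mulmxA Qv -scalemxAr.
rewrite map_scalar_mx mul_scalar_mx => /matrixP/(_ 0 0); rewrite !mxE expr0 mulr1 => E.
have : 1 <= `|((\det A)%:~R : R)| by rewrite -intr_norm ler1z -gtz0_ge1 normr_gt0.
rewrite /= in E; rewrite -E normrM => /le_trans; apply; apply: ler_wpM2l => //.
apply: (le_trans (ler_norm_sum _ _ _)); rewrite mulrAC mulr_sumr; apply: ler_sum => j _.
rewrite normrM ler_wpM2r // !mxE -intr_norm -[d`!%:R]mulrz_nat -rmorphXn -rmorphM ler_int.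
rewrite normrM normrX normrN1 expr1n mul1r.
apply: (@le_trans _ _ (d`!%:R * \prod_(i < d) mx_norm1 _ A)).
  by apply: det_norm_le => i k; rewrite !mxE mx_norm1_entry.
by rewrite prodr_const card_ord.
Qed.

(** * Determinants of exponential monomials *)

Definition poly_norm (m : nat) (Y : R) (p : {poly R}) : R := \sum_(i < m) `|p`_i| * Y ^+ i.

Lemma horner_le_poly_norm (m : nat) (Y y : R) (p : {poly R}) :
  (size p <= m)%N -> `|y| <= Y -> `|p.[y]| <= poly_norm m Y p.
Proof.
move=> sp yY; rewrite (horner_coef_wide _ sp); apply: (le_trans (ler_norm_sum _ _ _)).
apply: ler_sum => i _; rewrite normrM ler_wpM2l // normrX lerXn2r // nnegrE //.
exact: le_trans yY.
Qed.

(** The factor [i + 1 <= m] created by differentiation is absorbed by the power of [Y] that is lost.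
    Repeated derivatives therefore bring in no factorial. *)
Lemma poly_norm_deriv (m : nat) (Y : R) (p : {poly R}) :
  (size p <= m)%N -> m%:R <= Y -> poly_norm m Y p^`() <= poly_norm m Y p.
Proof.
case: m => [|m] sp mY; first by rewrite /poly_norm !big_ord0.
have Y0 : 0 <= Y by apply: le_trans mY.
rewrite /poly_norm big_ord_recr [leRHS]big_ord_recl /= coef_deriv nth_default // mul0rn.
rewrite normr0 mul0r addr0; apply: ler_wpDl; first by rewrite mulr_ge0 // exprn_ge0.
apply: ler_sum => i _; rewrite coef_deriv normrMn exprS mulrA -mulr_natr.
rewrite ler_wpM2r ?exprn_ge0 // ler_wpM2l // (le_trans _ mY) // ler_nat.
exact: leq_trans (ltn_ord i) _.
Qed.

Lemma poly_norm_exp_deriv (m : nat) (Y w : R) (p : {poly R}) :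
  (size p <= m)%N -> m%:R <= Y ->
  poly_norm m Y (exp_deriv w p) <= (1 + `|w|) * poly_norm m Y p.
Proof.
move=> sp mY; have Y0 : 0 <= Y by apply: le_trans mY.
rewrite mulrDl mul1r.
apply: (@le_trans _ _ (poly_norm m Y p^`() + `|w| * poly_norm m Y p)); last first.
  by rewrite lerD2r poly_norm_deriv.
rewrite mulr_sumr -big_split /=; apply: ler_sum => i _.
rewrite /exp_deriv coefD coefZ mulrA -mulrDl ler_wpM2r ?exprn_ge0 //.
by rewrite -normrM ler_normD.
Qed.

Lemma size_iter_exp_deriv (m n : nat) (w : R) (p : {poly R}) :
  (size p <= m)%N -> (size (iter n (exp_deriv w) p) <= m)%N.
Proof.
move=> sp; elim: n => //= n IH; rewrite (leq_trans (size_polyD _ _)) // geq_max.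
rewrite (leq_trans (leq_trans (size_poly _ _) (leq_pred _)) IH).
exact: leq_trans (size_scale_leq _ _) IH.
Qed.

Lemma poly_norm_iter_exp_deriv (m n : nat) (Y w : R) (p : {poly R}) :
  (size p <= m)%N -> m%:R <= Y ->
  poly_norm m Y (iter n (exp_deriv w) p) <= (1 + `|w|) ^+ n * poly_norm m Y p.
Proof.
move=> sp mY; elim: n => [|n IH]; first by rewrite mul1r.
rewrite exprS -mulrA; apply: le_trans (poly_norm_exp_deriv _ _ _ _ _ mY) _.
  exact: size_iter_exp_deriv.
by rewrite ler_wpM2l // addr_ge0.
Qed.

Lemma poly_normXn (m i : nat) (Y : R) : (i < m)%N -> poly_norm m Y 'X^i = Y ^+ i.
Proof.
move=> im; rewrite /poly_norm (bigD1 (Ordinal im)) //= coefXn eqxx normr1 mul1r.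
rewrite big1 ?addr0 // => j ji; rewrite coefXn.
by rewrite -[X in _ == X]/(val (Ordinal im)) (inj_eq val_inj) (negbTE ji) normr0 mul0r.
Qed.

Lemma exp_gt0 (x : R) : 0 < exp x.
Proof. exact/RltP/exp_pos. Qed.

Lemma ler_exp (x y : R) : x <= y -> exp x <= exp y.
Proof.
rewrite le_eqVlt => /predU1P[-> //|/RltP xy].
exact/ltW/RltP/exp_increasing.
Qed.

(** The column index [a] encodes the monomial [x^(a / n) exp (lam (a mod n) x)]. A linear relation
    between the columns is an exponential polynomial with [n] frequencies and coefficients of size
    at most [D], vanishing at [D * n] points. *)
Lemma exp_monomials_det_neq0 (n D : nat) (lam : R) (x : 'I_(D * n) -> R) :
  injective x -> lam != 0 -> (0 < n)%N ->
  \det (\matrix_(p, a) exp_poly (lam * (a %% n)%:R) 'X^(a %/ n) (x p)) != 0.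
Proof.
move=> xinj lam0 n0; rewrite -det_tr; apply/negP => /det0P[v v0 vM].
pose w (j : 'I_n) := lam * j%:R.
pose pl (j : 'I_n) := \sum_(a < D * n | (a %% n)%N == j) v 0 a *: 'X^(a %/ n) : {poly R}.
have md a : (a %% n < n)%N by rewrite ltn_mod.
have aD (a : 'I_(D * n)) : (a %/ n < D)%N by rewrite ltn_divLR.
have spl j : (size (pl j) <= D)%N.
  rewrite /pl; elim/big_rec: _ => [|a p _ IH]; first by rewrite size_poly0.
  rewrite (leq_trans (size_polyD _ _)) // geq_max IH andbT.
  by rewrite (leq_trans (size_scale_leq _ _)) // size_polyXn.
have pl0 : forall j, pl j = 0.
  apply: (@exp_poly_zeros n w pl [seq x p | p <- enum 'I_(D * n)]).
  - by move=> i j /(mulfI lam0)/eqP; rewrite eqr_nat => /eqP/val_inj.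
  - by rewrite map_inj_uniq // enum_uniq.
  - rewrite size_map size_enum_ord mulnC -[n in (n * D)%N]card_ord -sum_nat_const.
    exact: leq_sum.
  move=> _ /mapP[p _ ->]; have /matrixP/(_ 0 p) := vM; rewrite !mxE => E.
  rewrite -[RHS]E (partition_big (fun a : 'I_(D * n) => Ordinal (md a)) xpredT) //=.
  apply: eq_bigr => j _; rewrite /exp_poly /pl horner_sum mulr_suml.
  apply: eq_big => [a|a /eqP aj]; first by rewrite -(inj_eq val_inj).
  by rewrite !mxE hornerZ aj mulrA.
case/negP: v0; apply/eqP/rowP => a; rewrite mxE.
have := congr1 (fun q : {poly R} => q`_(a %/ n)) (pl0 (Ordinal (md a))).
rewrite coef0 /pl coef_sum (bigD1 a) //= coefZ coefXn eqxx mulr1 big1 ?addr0 //.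
move=> c /andP[/eqP cm ca]; rewrite coefZ coefXn; case: eqP => [e|]; rewrite ?mulr0 //.
case/eqP: ca; apply: val_inj; rewrite /= (divn_eq c n) cm -e -divn_eq //.
Qed.

(* Growth of order at most [exp (O(n^8 + n^7 log n))]: negligible against
   [n^(N (N - 1) / 2)] for [N = n^4]. *)
Definition small (f : nat -> R) := exists (H : R) (q : nat), 1 <= H /\
  forall n, (0 < n)%N -> 0 <= f n <= H ^+ (n ^ 8) * n%:R ^+ (q * n ^ 7).

Lemma smallM (f g : nat -> R) : small f -> small g -> small (fun n => f n * g n).
Proof.
move=> [H [q [H1 Hf]]] [H' [q' [H1' Hg]]]; exists (H * H'), (q + q')%N.
split; first by rewrite mulr_ege1.
move=> n n0; have /andP[f0 fH] := Hf n n0; have /andP[g0 gH] := Hg n n0.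
by rewrite mulr_ge0 //= exprMn mulnDl exprD mulrACA ler_pM.
Qed.

Lemma smallX (f : nat -> R) (d : nat) : small f -> small (fun n => f n ^+ d).
Proof.
move=> Hf; elim: d => [|d [H [q [H1 HX]]]].
  exists 1, 0%N; split=> // n _; by rewrite expr0 expr1n mul0n ler01 expr0 mulr1 lexx.
have [H' [q' [H1' HX']]] : small (fun n => f n * f n ^+ d).
  by apply: smallM => //; exists H, q.
by exists H', q'; split=> // n n0; rewrite exprS HX'.
Qed.

Lemma small_pow (c : R) (e : nat -> nat) : 0 <= c ->
  (forall n, (0 < n)%N -> (e n <= n ^ 8)%N) -> small (fun n => c ^+ e n).
Proof.
move=> c0 He; exists (1 + c), 0%N; split; first by rewrite lerDl.
move=> n n0; rewrite exprn_ge0 //= mul0n expr0 mulr1.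
apply: (@le_trans _ _ ((1 + c) ^+ e n)).
  by rewrite lerXn2r ?nnegrE ?addr_ge0 // lerDr.
by rewrite ler_weXn2l ?lerDl // He.
Qed.

Lemma small_natX (q : nat) (e : nat -> nat) :
  (forall n, (0 < n)%N -> (e n <= q * n ^ 7)%N) -> small (fun n => n%:R ^+ e n).
Proof.
move=> He; exists 1, q; split=> // n n0; rewrite exprn_ge0 //= expr1n mul1r.
by rewrite ler_weXn2l ?ler1n // He.
Qed.

Lemma small_le (f g : nat -> R) : small g ->
  (forall n, (0 < n)%N -> 0 <= f n <= g n) -> small f.
Proof.
move=> [H [q [H1 Hg]]] fg; exists H, q; split=> // n n0.
have /andP[-> fgn] := fg n n0; apply: (le_trans fgn).
by have /andP[] := Hg n n0.
Qed.

Lemma small_eq (f g : nat -> R) : small g -> f =1 g -> small f.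
Proof.
by move=> [H [q [H1 Hg]]] fg; exists H, q; split=> // n n0; rewrite fg Hg.
Qed.

Lemma small_cst (c : R) : 0 <= c -> small (fun=> c).
Proof.
move=> c0; apply: (small_eq _ (fun=> c ^+ 1)) => [|n]; last by rewrite expr1.
by apply: small_pow => // n n0; rewrite expn_gt0 n0.
Qed.

Lemma small_lt_natX (f : nat -> R) : small f ->
  exists2 n, (0 < n)%N & f n < n%:R ^+ 'C(n ^ 4, 2).
Proof.
move=> [H [q [H1 Hf]]].
have H0 : 0 <= H by apply: le_trans H1.
(* The inequality is raised to the fourth power: [H^4 < n] makes the first factor less than
   [n^(n^8)], and [n >= 4 q + 4] gives [n^8 + 4 q n^7 <= 4 'C(n^4, 2)]. *)
pose n := ((Num.bound (H ^+ 4)) + 4 * q + 4)%N.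
have n0 : (0 < n)%N by rewrite /n; lia.
exists n => //; have /andP[_ fH] := Hf n n0; apply: (le_lt_trans fH).
rewrite -(@ltr_pXn2r _ 4) ?nnegrE ?mulr_ge0 ?exprn_ge0 //.
have nH : H ^+ 4 < n%:R.
  have := archi_boundP (exprn_ge0 4 H0) => /lt_le_trans; apply.
  by rewrite ler_nat /n -addnA leq_addr.
rewrite exprMn -!exprM [(n ^ 8 * 4)%N]mulnC exprM.
apply: (@lt_le_trans _ _ (n%:R ^+ (n ^ 8) * n%:R ^+ (q * n ^ 7 * 4))).
  by rewrite ltr_pM2r ?exprn_gt0 ?ltr0n // ltrXn2r ?nnegrE ?exprn_ge0 //.
rewrite -exprD ler_weXn2l ?ler1n // bin2.
have nq : (4 * q + 4 <= n)%N by rewrite /n; lia.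
set N := (n ^ 4)%N; have EN : N = (n ^ 3 * n)%N by rewrite /N; lia.
have -> : (n ^ 8 = N * N)%N by rewrite /N; lia.
have -> : (n ^ 7 = N * n ^ 3)%N by rewrite /N; lia.
have N0 : (0 < N)%N by rewrite /N expn_gt0 n0.
have n30 : (0 < n ^ 3)%N by rewrite expn_gt0 n0.
have ev : ((N * N.-1)./2 * 2 = N * N.-1)%N.
  rewrite muln2 halfK; suff -> : odd (N * N.-1) = false by rewrite subn0.
  by rewrite oddM -subn1 oddB //=; case: odd.
have : (N + 4 * q * n ^ 3 + 2 <= 2 * N)%N by rewrite EN; nia.
nia.
Qed.

Lemma fact_le_exp (n : nat) : (n`! <= n ^ n)%N.
Proof.
rewrite fact_prod big_add1 /= big_mkord -[X in (_ <= _ ^ X)%N](card_ord n) -prod_nat_const.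
by apply: leq_prod => i _; apply: ltn_ord.
Qed.

(** Each derivative multiplies [poly_norm D Y] by at most [1 + n |lam|], and the monomials start
    from at most [Y^D]. This gives [c = 1 + n |lam|] and [B = Y^D exp (|lam| n X)] in
    [det_interpolation_bound]. *)
Lemma exp_monomials_det_bound (n D : nat) (lam X Y : R) (x : 'I_(D * n) -> R) :
  (0 < n)%N -> injective x -> (forall p, 0 <= x p <= X) -> D%:R <= Y -> X <= Y -> 1 <= Y ->
  `|\det (\matrix_(p, a) exp_poly (lam * (a %% n)%:R) 'X^(a %/ n) (x p))| *
    (D * n)%:R ^+ 'C(D * n, 2) <=
  (D * n)`!%:R * (exp (D * n)%:R * (Y ^+ D * exp (`|lam| * n%:R * X))) ^+ (D * n) *
    ((1 + n%:R * `|lam|) * X) ^+ 'C(D * n, 2).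
Proof.
move=> n0 xinj xX DY XY Y1; have Y0 : 0 <= Y by apply: le_trans Y1.
have [N0|N0] := eqVneq (D * n)%N 0%N.
  by rewrite N0 in x xinj xX *; rewrite det_mx00 normr1 !expr0 !mulr1.
have X0 : 0 <= X.
  have N1 : (0 < D * n)%N by rewrite lt0n.
  by have /andP[/le_trans] := xX (Ordinal N1); apply.
pose w (a : 'I_(D * n)) := lam * (a %% n)%:R.
pose g (a : 'I_(D * n)) m := exp_poly (w a) (iter m (exp_deriv (w a)) 'X^(a %/ n)).
have aD (a : 'I_(D * n)) : (a %/ n < D)%N by rewrite ltn_divLR.
have wn a : `|w a| <= n%:R * `|lam|.
  rewrite /w normrM normr_nat mulrC ler_wpM2r // ler_nat ltnW // ltn_mod //.
have := @det_interpolation_bound _ g 0 X (Y ^+ D * exp (`|lam| * n%:R * X))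
   (1 + n%:R * `|lam|) x.
rewrite subr0; apply=> //.
- by move=> i m; apply: is_deriv_exp_poly.
- move=> a m y /andP[y0 yX]; rewrite /g /exp_poly normrM [`|exp _|]gtr0_norm ?exp_gt0 //.
  rewrite [leRHS]mulrAC ler_pM //; first exact/ltW/exp_gt0.
    have sX : (size ('X^(a %/ n) : {poly R}) <= D)%N by rewrite size_polyXn.
    apply: le_trans (@horner_le_poly_norm D Y y _ (size_iter_exp_deriv _ _ _ _ sX) _) _.
      by rewrite ger0_norm // (le_trans yX).
    apply: le_trans (poly_norm_iter_exp_deriv _ _ _ _ _ sX DY) _.
    rewrite poly_normXn // mulrC ler_pM ?exprn_ge0 ?addr_ge0 //.
      by rewrite ler_weXn2l // ltnW.
    by rewrite lerXn2r ?nnegrE ?addr_ge0 ?mulr_ge0 // lerD2l.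
  apply: ler_exp; apply: le_trans (ler_norm _) _; rewrite normrM [`|y|]ger0_norm //.
  by rewrite ler_pM // (le_trans (wn a)) // mulrC.
- by rewrite mulr_ge0 ?exprn_ge0 // ltW // exp_gt0.
- by rewrite addr_ge0 // mulr_ge0.
Qed.

Section SubmultiplicativeSize.
Variables (d' : nat) (nu : {poly int} -> R).
Hypotheses (nu0 : forall Q, 0 <= nu Q)
  (nuDM : forall P Q, nu (P + Q) <= nu P + nu Q /\ nu (P * Q) <= nu P * nu Q)
  (nuC : forall c : int, nu c%:P <= d'%:R * `|c%:~R|).

Lemma submul_exp (Q : {poly int}) (m : nat) : nu (Q ^+ m) <= d'%:R * nu Q ^+ m.
Proof.
elim: m => [|m IH].
  by rewrite expr0 mulr1; have := nuC 1; rewrite normr1 mulr1.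
rewrite exprS; apply: le_trans (nuDM _ _).2 _.
by rewrite exprS mulrCA ler_wpM2l.
Qed.

Lemma submul_prod (I : Type) (r : seq I) (F : I -> {poly int}) :
  nu (\prod_(i <- r) F i) <= d'%:R * \prod_(i <- r) nu (F i).
Proof.
elim: r => [|i r IH].
  by rewrite !big_nil mulr1; have := nuC 1; rewrite normr1 mulr1.
rewrite !big_cons; apply: le_trans (nuDM _ _).2 _.
by rewrite mulrCA ler_wpM2l.
Qed.

Lemma submul_sum (I : Type) (r : seq I) (F : I -> {poly int}) :
  nu (\sum_(i <- r) F i) <= \sum_(i <- r) nu (F i).
Proof.
elim: r => [|i r IH].
  by rewrite !big_nil; have := nuC 0; rewrite normr0 mulr0.
by rewrite !big_cons; apply: le_trans (nuDM _ _).1 _; rewrite lerD2l.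
Qed.

(** One factor [d'] bounds the size of the sign of the permutation, the other comes from
    [submul_prod], where it bounds the size of the empty product. *)
Lemma submul_det (N : nat) (M : 'M[{poly int}]_N) (B : R) :
  (forall i j, nu (M i j) <= B) -> nu (\det M) <= N`!%:R * (d'%:R ^+ 2 * B ^+ N).
Proof.
move=> HB; apply: le_trans (submul_sum _ _ _) _.
rewrite (_ : _ * _ = \sum_(s : 'S_N) (d'%:R ^+ 2 * B ^+ N)); last first.
  by rewrite sumr_const card_Sn mulr_natl.
apply: ler_sum => s _; apply: le_trans (nuDM _ _).2 _.
rewrite expr2 -mulrA ler_pM //.
  rewrite (_ : (-1) ^+ s = ((-1) ^+ s)%:P); last by rewrite rmorphXn rmorphN1.
  by apply: le_trans (nuC _) _; rewrite rmorphXn normrX rmorphN1 normrN1 expr1n mulr1.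
apply: le_trans (submul_prod _ _ _) _; rewrite ler_wpM2l //.
rewrite -[N in B ^+ N]card_ord -prodr_const; apply: ler_prod => i _.
by rewrite nu0 HB.
Qed.

End SubmultiplicativeSize.

(** * A real case of the Gelfond-Schneider theorem *)

Lemma ler_pXn (x M : R) (i m : nat) : 0 <= x <= M -> 1 <= M -> (i <= m)%N ->
  x ^+ i <= M ^+ m.
Proof.
move=> /andP[x0 xM] M1 im; apply: (@le_trans _ _ (M ^+ i)).
  by rewrite lerXn2r // nnegrE (le_trans x0).
by rewrite ler_weXn2l.
Qed.

(** Here [A = exp lam], so that [A^L = L] and [A^k = u / w]; [L] is assumed irrational, and [b],
    [d], [K], [nu] are the data of the Liouville inequality for [L]. *)
Section GelfondSchneider.
Variables (L lam : R) (k : nat) (u w b : int) (d : nat) (K : R) (nu : {poly int} -> R).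
Hypotheses (L0 : 0 < L) (lam0 : lam != 0) (k0 : (0 < k)%N) (w0 : w != 0)
  (expL : exp (lam * L) = L) (expk : exp (lam * k%:R) = u%:~R / w%:~R)
  (irrL : forall p q : int, q != 0 -> q%:~R * L != p%:~R)
  (b0 : b != 0) (nu0 : forall Q, 0 <= nu Q)
  (nuDM : forall P Q, nu (P + Q) <= nu P + nu Q /\ nu (P * Q) <= nu P * nu Q)
  (nuC : forall c : int, nu c%:P <= d.+1%:R * `|c%:~R|)
  (nuL : forall Q, int_eval Q (b%:~R * L) != 0 ->
        1 <= `|int_eval Q (b%:~R * L)| * (K * nu Q ^+ d)).

(** The point [k s + L t], with [s] and [t] the quotient and remainder of [p] by [n^2]; there
    [A^(j x)] takes the value [(u / w)^(j s) L^(j t)]. *)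
Let point (n p : nat) := (k * (p %/ n ^ 2))%:R + (p %% n ^ 2)%:R * L.

Let point_inj (n : nat) : (0 < n)%N -> injective (fun p : 'I_(n ^ 3 * n) => point n p).
Proof.
move=> n0 p q E; apply: val_inj.
rewrite /= (divn_eq p (n ^ 2)) (divn_eq q (n ^ 2)).
have Em : (p %% n ^ 2 = q %% n ^ 2)%N.
  apply/eqP/negPn/negP => ne.
  have := irrL ((k * (q %/ n ^ 2))%:Z - (k * (p %/ n ^ 2))%:Z)
    ((p %% n ^ 2)%:Z - (q %% n ^ 2)%:Z).
  rewrite subr_eq0 eqz_nat => /(_ ne)/eqP; apply.
  by move: E; rewrite /point !rmorphB /= -!pmulrn => E; lra.
move: E; rewrite /point Em => /addIr/eqP; rewrite eqr_nat eqn_pmul2l // => /eqP ->.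
by [].
Qed.

(** One constant above every size met in [entry_size]; the square makes room for the product of [k]
    and [|b|]. *)
Let M := d.+1%:R * (1 + k%:R + `|b%:~R| + `|u%:~R| + `|w%:~R| + nu 'X) ^+ 2.

Let M_ge : [/\ 1 <= M, d.+1%:R <= M, `|b%:~R| <= M, `|u%:~R| <= M & `|w%:~R| <= M] /\
  nu 'X <= M /\ d.+1%:R * (k%:R * `|b%:~R| + nu 'X) <= M.
Proof.
have k1 : 1 <= k%:R :> R by rewrite ler1n.
have := nu0 'X; have := normr_ge0 (b%:~R : R); have := normr_ge0 (u%:~R : R).
have := normr_ge0 (w%:~R : R); rewrite /M.
move: `|b%:~R| `|u%:~R| `|w%:~R| (nu 'X) => B U W V W0 U0 B0 V0.
set T := 1 + k%:R + B + U + W + V.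
have T1 : 1 <= T by rewrite /T; lra.
have TT : T <= T ^+ 2 by rewrite expr2 ler_peMr // (le_trans ler01).
have TB : k%:R * B + V <= T ^+ 2.
  apply: (@le_trans _ _ ((k%:R + B + V) ^+ 2)); last first.
    rewrite lerXn2r ?nnegrE // /T; lra.
  by rewrite -subr_ge0; have := mulr_ge0 B0 V0; nra.
have d1 : 1 <= d.+1%:R :> R by rewrite ler1n.
have HT y : y <= T -> y <= d.+1%:R * T ^+ 2.
  move=> yT; apply: (le_trans yT); apply: (le_trans TT).
  by rewrite ler_peMl // exprn_ge0 // (le_trans ler01).
split; last by split; [apply: HT; rewrite /T; lra|rewrite ler_wpM2l].
split; try by apply: HT; rewrite /T; lra.
by rewrite ler_peMr // (le_trans T1).
Qed.

Let M1 : 1 <= M. Proof. by have [[]] := M_ge. Qed.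
Let M0 : 0 <= M. Proof. exact: le_trans M1. Qed.

(* Multiplying the matrix entries by [wt n] makes them integer polynomials in [b L]. *)
Let wt (n : nat) := b%:~R ^+ (2 * n ^ 3) * (w%:~R ^+ (n ^ 3) : R).

(** Of the factor [b^(2 n^3)], one half serves [(k s + L t)^i] and the other [L^(j t)], while
    [w^(n^3)] serves [(u / w)^(j s)]: the exponents [i], [j t] and [j s] are at most [n^3]. *)
Let entry (n p a : nat) : {poly int} :=
  let i := (a %/ n)%N in let j := (a %% n)%N in
  let s := (p %/ n ^ 2)%N in let t := (p %% n ^ 2)%N in
  (b ^+ (n ^ 3 - i) * b ^+ (n ^ 3 - j * t) * u ^+ (j * s) * w ^+ (n ^ 3 - j * s))%:P *
  ((b * (k * s)%:Z)%:P + (t%:Z)%:P * 'X) ^+ i * 'X ^+ (j * t).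

Let index_le (n p a : nat) : (0 < n)%N -> (p < n ^ 3 * n)%N -> (a < n ^ 3 * n)%N ->
  [/\ (a %/ n <= n ^ 3)%N, (a %% n * (p %% n ^ 2) <= n ^ 3)%N,
      (a %% n * (p %/ n ^ 2) <= n ^ 3)%N, (p %/ n ^ 2 <= n ^ 2)%N & (p %% n ^ 2 <= n ^ 2)%N].
Proof.
move=> n0 pn an.
have h1 : (a %/ n < n ^ 3)%N by rewrite ltn_divLR.
have h2 : (a %% n < n)%N by rewrite ltn_mod.
have n20 : (0 < n ^ 2)%N by rewrite expn_gt0 n0.
have h3 : (p %% n ^ 2 < n ^ 2)%N by rewrite ltn_mod.
have h4 : (p %/ n ^ 2 < n ^ 2)%N by rewrite ltn_divLR // -expnD -[(2 + 2)%N]/(3.+1) expnSr.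
split; try exact: ltnW.
  by rewrite (expnS n 2) leq_mul // ltnW.
by rewrite (expnS n 2) leq_mul // ltnW.
Qed.

Let entry_eval (n p a : nat) : (0 < n)%N -> (p < n ^ 3 * n)%N -> (a < n ^ 3 * n)%N ->
  int_eval (entry n p a) (b%:~R * L) =
  wt n * exp_poly (lam * (a %% n)%:R) 'X^(a %/ n) (point n p).
Proof.
move=> n0 pn an; have [h1 h2 h3 h4 h5] := index_le n p a n0 pn an.
rewrite /entry /exp_poly /point /wt.
move: (a %/ n)%N (a %% n)%N (p %/ n ^ 2)%N (p %% n ^ 2)%N h1 h2 h3 h4 h5.
move: (n ^ 3)%N => D i j s t h1 h2 h3 h4 h5.
have -> : exp (lam * j%:R * ((k * s)%:R + t%:R * L)) =
    u%:~R ^+ (j * s) / w%:~R ^+ (j * s) * L ^+ (j * t).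
  have -> : lam * j%:R * ((k * s)%:R + t%:R * L) =
     (lam * k%:R) *+ (j * s) + (lam * L) *+ (j * t).
    by rewrite -[(lam * k%:R) *+ _]mulr_natr -[(lam * L) *+ _]mulr_natr !natrM; ring.
  by rewrite -expRD -!expRX expk expL expr_div_n.
rewrite !int_evalM !int_evalXn int_evalD int_evalM !int_evalC int_evalX.
rewrite hornerXn !intrM !rmorphXn /=.
have wr0 : w%:~R != 0 :> R by rewrite intr_eq0.
rewrite -!pmulrn.
have -> : b%:~R * (k * s)%:R + t%:R * (b%:~R * L) = b%:~R * ((k * s)%:R + t%:R * L) :> R by ring.
rewrite !exprMn mul2n -addnn exprD.
have -> : b%:~R ^+ D * b%:~R ^+ D = (b%:~R ^+ (D - i) * b%:~R ^+ i) *
    (b%:~R ^+ (D - j * t) * b%:~R ^+ (j * t)) :> R by rewrite -!exprD !subnK.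
have -> : w%:~R ^+ D = w%:~R ^+ (D - j * s) * w%:~R ^+ (j * s) :> R by rewrite -exprD subnK.
have : w%:~R ^+ (j * s) != 0 :> R by rewrite expf_neq0.
move: (w%:~R ^+ (j * s)) => Wjs W0; field.
exact: W0.
Qed.

Let entry_size (n p a : nat) : (0 < n)%N -> (p < n ^ 3 * n)%N -> (a < n ^ 3 * n)%N ->
  nu (entry n p a) <= M ^+ (3 + 6 * n ^ 3) * n%:R ^+ (2 * n ^ 3).
Proof.
move=> n0 pn an; have [h1 h2 h3 h4 h5] := index_le n p a n0 pn an.
have [[Q1 Md Mb Mu Mw] [MX Mlin]] := M_ge; have Q0 : 0 <= M by apply: M0.
move: M Q1 Q0 Md Mb Mu Mw MX Mlin => Q Q1 Q0 Md Mb Mu Mw MX Mlin.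
have n2 : 1 <= n%:R ^+ 2 :> R by rewrite -natrX ler1n expn_gt0 n0.
rewrite /entry.
move: (a %/ n)%N (a %% n)%N (p %/ n ^ 2)%N (p %% n ^ 2)%N h1 h2 h3 h4 h5.
move: (n ^ 3)%N => D i j s t h1 h2 h3 h4 h5.
have -> : Q ^+ (3 + 6 * D) * n%:R ^+ (2 * D) =
   (Q * Q ^+ (4 * D)) * (Q * (n%:R ^+ 2 * Q) ^+ D) * (Q * Q ^+ D).
  have -> : (3 + 6 * D = 1 + 4 * D + (1 + D) + (1 + D))%N by clear; lia.
  rewrite exprMn -exprM !exprD !expr1; ring.
apply: le_trans (nuDM _ _).2 _; apply: ler_pM => //; last first.
  apply: le_trans (submul_exp _ _ nu0 nuDM nuC _ _) _ => //.
  by rewrite ler_pM ?exprn_ge0 // ler_pXn // nu0.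
apply: le_trans (nuDM _ _).2 _; apply: ler_pM => //; last first.
  apply: le_trans (submul_exp _ _ nu0 nuDM nuC _ _) _ => //.
  rewrite ler_pM ?exprn_ge0 // ler_pXn ?nu0 ?mulr_ege1 ?ler1n //=.
  apply: le_trans (nuDM _ _).1 _.
  apply: (@le_trans _ _ (d.+1%:R * `|(b * (k * s)%:Z)%:~R| + d.+1%:R * `|t%:~R| * nu 'X)).
    apply: lerD => //; apply: le_trans (nuDM _ _).2 _.
    by rewrite ler_wpM2r.
  rewrite intrM normrM -!pmulrn !normr_nat natrM.
  apply: (@le_trans _ _ (n%:R ^+ 2 * (d.+1%:R * (k%:R * `|b%:~R| + nu 'X)))).
    have hs : s%:R <= n%:R ^+ 2 :> R by rewrite -natrX ler_nat.
    have ht : t%:R <= n%:R ^+ 2 :> R by rewrite -natrX ler_nat.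
    rewrite (_ : _ + _ = d.+1%:R * (s%:R * (k%:R * `|b%:~R|) + t%:R * nu 'X)); last by ring.
    by rewrite [leRHS]mulrCA ler_wpM2l // mulrDr lerD // ler_wpM2r // mulr_ge0.
  by rewrite ler_wpM2l // (le_trans ler01).
apply: le_trans (nuC _) _; rewrite ler_pM //.
have -> : Q ^+ (4 * D) = Q ^+ D * Q ^+ D * Q ^+ D * Q ^+ D.
  by rewrite -!exprD !mulSn mul0n addn0 !addnA.
rewrite !intrM !normrM !rmorphXn !normrX.
by rewrite !ler_pM ?mulr_ge0 ?exprn_ge0 // ler_pXn ?normr_ge0 // leq_subr.
Qed.

Let c1 := 1 + k%:R + L.

Let c1_ge1 : 1 <= c1.
Proof. by rewrite /c1 -addrA lerDl addr_ge0 // ltW. Qed.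

(** The Liouville bound for [\det E] is confronted with the analytic bound for [\det Mx]. The latter
    compares [N = n^4] with frequencies times length of the interval, of order [n * n^2]; the
    surplus factor [n] is what remains on the left. *)
Let matrix_bound (n N : nat) : (0 < n)%N -> N = (n ^ 3 * n)%N ->
  n%:R ^+ 'C(N, 2) <=
    (`|wt n| ^+ N * (`|K| * (N`!%:R * (d.+1%:R ^+ 2 *
       (M ^+ (3 + 6 * n ^ 3) * n%:R ^+ (2 * n ^ 3)) ^+ N)) ^+ d)) *
    (N`!%:R * (exp N%:R * ((c1 * n%:R ^+ 3) ^+ (n ^ 3) *
       exp (`|lam| * c1) ^+ (n ^ 3))) ^+ N) *
    ((1 + `|lam|) * c1) ^+ 'C(N, 2).
Proof.
move=> n0 -> {N}; set N := (n ^ 3 * n)%N.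
have n1 : 1 <= n%:R :> R by rewrite ler1n.
have nn : 0 <= n%:R :> R by [].
have c10 : 0 <= c1 by apply: le_trans c1_ge1.
pose Mx := \matrix_(p < N, a < N) exp_poly (lam * (a %% n)%:R) 'X^(a %/ n) (point n p).
pose E := \matrix_(p < N, a < N) entry n p a.
have D0 : \det Mx != 0 by apply: exp_monomials_det_neq0 => //; apply: point_inj.
have wt0 : wt n != 0 by rewrite mulf_neq0 // expf_neq0 // intr_eq0.
have EE : int_eval (\det E) (b%:~R * L) = wt n ^+ N * \det Mx.
  rewrite det_int_eval -detZ; congr (\det _); apply/matrixP => p a.
  by rewrite !mxE entry_eval.
have := nuL (\det E); rewrite EE mulf_neq0 ?expf_neq0 // => /(_ isT) lo.
(* The points lie in [[0, c1 n^2]], and [Y = c1 n^3] is at least the number [n^3] of powers of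
   [x]. *)
have up : `|\det Mx| * N%:R ^+ 'C(N, 2) <= _ :=
  @exp_monomials_det_bound n (n ^ 3) lam (c1 * n%:R ^+ 2)%R (c1 * n%:R ^+ 3)%R _ n0
    (point_inj n n0) _ _ _ _.
have {}up : `|\det Mx| * n%:R ^+ 'C(N, 2) <=
   (N`!%:R * (exp N%:R * ((c1 * n%:R ^+ 3) ^+ (n ^ 3) *
       exp (`|lam| * c1) ^+ (n ^ 3))) ^+ N) *
    ((1 + `|lam|) * c1) ^+ 'C(N, 2).
  (* Both sides are multiplied by [(n^3)^'C(N, 2)], which completes [N] on the left and dominates
     [(1 + n |lam|) c1 n^2 <= (1 + |lam|) c1 n^3] on the right. *)
  have n3T : 0 < (n%:R ^+ 3) ^+ 'C(N, 2) :> R by rewrite !exprn_gt0 // ltr0n.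
  rewrite -(ler_pM2r n3T) [leLHS](_ : _ = `|\det Mx| * N%:R ^+ 'C(N, 2)); last first.
    by rewrite -mulrA -exprMn -natrX -natrM mulnC.
  apply: le_trans (up _ _ _ _) _.
  - move=> p; rewrite /point addr_ge0 ?mulr_ge0 ?(ltW L0) //=.
    have [_ _ _ h4 h5] := index_le n p p n0 (ltn_ord p) (ltn_ord p).
    have hs : (p %/ n ^ 2)%:R <= n%:R ^+ 2 :> R by rewrite -natrX ler_nat.
    have ht : (p %% n ^ 2)%:R <= n%:R ^+ 2 :> R by rewrite -natrX ler_nat.
    rewrite natrM /c1 !mulrDl mul1r -addrA ler_wpDl ?exprn_ge0 //.
    by rewrite lerD // ?ler_wpM2l // mulrC ler_wpM2l // ltW.
  - by rewrite natrX ler_peMl ?exprn_ge0.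
  - by rewrite ler_wpM2l // ler_weXn2l.
  - by rewrite mulr_ege1 // exprn_ege1.
  have e0 y : 0 <= exp y by apply/ltW/exp_gt0.
  have Y0 : 0 <= c1 * n%:R ^+ 3 by rewrite mulr_ge0 // exprn_ge0.
  have l1 : 0 <= 1 + n%:R * `|lam| by rewrite addr_ge0 // mulr_ge0.
  have X0 : 0 <= c1 * n%:R ^+ 2 by rewrite mulr_ge0 // exprn_ge0.
  rewrite -[leRHS]mulrA -[X in _ <= _ * X]exprMn.
  have -> : exp (`|lam| * c1) ^+ (n ^ 3) = exp (`|lam| * n%:R * (c1 * n%:R ^+ 2)).
    by rewrite expRX -[_ *+ (n ^ 3)]mulr_natr natrX; congr exp; ring.
  apply: ler_wpM2l.
    by rewrite mulr_ge0 // exprn_ge0 // mulr_ge0 // mulr_ge0 // exprn_ge0.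
  apply: lerXn2r; rewrite ?nnegrE.
  - by rewrite mulr_ge0.
  - by rewrite mulr_ge0 ?exprn_ge0 // mulr_ge0 // addr_ge0.
  have -> // : (1 + `|lam|) * c1 * n%:R ^+ 3 = (n%:R + n%:R * `|lam|) * (c1 * n%:R ^+ 2) by ring.
  by rewrite ler_wpM2r // lerD2r.
rewrite -[leRHS]mulrA; move: up; set B := (X in _ <= X) => up.
have T0 : 0 <= n%:R ^+ 'C(N, 2) :> R by rewrite exprn_ge0.
apply: le_trans (ler_peMl T0 lo) _.
set V := N`!%:R * _.
have V0 : 0 <= V by rewrite !mulr_ge0 ?exprn_ge0 // mulr_ge0 ?exprn_ge0 ?M0.
have nuV : nu (\det E) ^+ d <= V ^+ d.
  rewrite lerXn2r ?nnegrE //; apply: submul_det => // p a; rewrite mxE.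
  exact: entry_size.
have KV : K * nu (\det E) ^+ d <= `|K| * V ^+ d.
  apply: (@le_trans _ _ (`|K| * nu (\det E) ^+ d)).
    by rewrite ler_wpM2r ?exprn_ge0 // ler_norm.
  by rewrite ler_wpM2l.
rewrite normrM normrX.
have -> : `|wt n| ^+ N * `|\det Mx| * (K * nu (\det E) ^+ d) * n%:R ^+ 'C(N, 2) =
  `|wt n| ^+ N * ((K * nu (\det E) ^+ d) * (`|\det Mx| * n%:R ^+ 'C(N, 2))) by ring.
rewrite -[leRHS]mulrA ler_wpM2l ?exprn_ge0 //.
apply: (@le_trans _ _ (`|K| * V ^+ d * (`|\det Mx| * n%:R ^+ 'C(N, 2)))).
  by rewrite ler_wpM2r // mulr_ge0.
by rewrite ler_wpM2l // mulr_ge0 // exprn_ge0.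
Qed.

(** Every factor on the right of [matrix_bound] is [small]: constants occur with exponents [O(n^8)]
    and powers of [n] with exponents [O(n^7)]. So the bound fails for some [n]. *)
Lemma gelfond_schneider_contradiction : False.
Proof.
have c10 : 0 <= c1 by apply: le_trans c1_ge1.
have e0 y : 0 <= exp y by apply/ltW/exp_gt0.
pose N n := (n ^ 3 * n)%N.
have pow7 n : (n ^ 3 * N n = n ^ 7)%N by rewrite /N mulnA -expnD -expnSr.
have pow8 n : (N n * N n = n ^ 8)%N by rewrite /N -expnSr -expnD.
have le78 n : (0 < n)%N -> (n ^ 7 <= n ^ 8)%N by move=> n0; apply: leq_pexp2l.
have sfact : small (fun n => (N n)`!%:R).
  apply: (small_le _ (fun n => n%:R ^+ (4 * N n))).
    by apply: (small_natX 4) => n n0; rewrite leq_mul // /N -expnSr leq_pexp2l.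
  move=> n n0; rewrite ler0n -natrX ler_nat.
  by rewrite expnM (_ : n ^ 4 = N n)%N ?fact_le_exp // /N -expnSr.
have s7 c : 0 <= c -> small (fun n => c ^+ (n ^ 3 * N n)).
  by move=> c0; apply: small_pow => // n n0; rewrite pow7 le78.
have sN c : 0 <= c -> small (fun n => c ^+ N n).
  by move=> c0; apply: small_pow => // n n0; rewrite /N -expnSr leq_pexp2l.
have sn q : small (fun n => n%:R ^+ (q * n ^ 3 * N n)).
  by apply: (small_natX q) => n _; rewrite -mulnA pow7.
have sT c : 0 <= c -> small (fun n => c ^+ 'C(N n, 2)).
  move=> c0; apply: small_pow => // n n0; rewrite -pow8 bin2.
  apply: (@leq_trans (N n * (N n).-1)); last by rewrite leq_mul // leq_pred.
  by rewrite leq_half_double -addnn -addnS leq_addr.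
have sbound : small (fun n =>
    (`|wt n| ^+ N n * (`|K| * ((N n)`!%:R * (d.+1%:R ^+ 2 *
       (M ^+ (3 + 6 * n ^ 3) * n%:R ^+ (2 * n ^ 3)) ^+ N n)) ^+ d)) *
    ((N n)`!%:R * (exp (N n)%:R * ((c1 * n%:R ^+ 3) ^+ (n ^ 3) *
       exp (`|lam| * c1) ^+ (n ^ 3))) ^+ N n) *
    ((1 + `|lam|) * c1) ^+ 'C(N n, 2)).
  apply: smallM; last by apply: sT; rewrite mulr_ge0 // addr_ge0.
  apply: smallM; apply: smallM => //.
  - apply: (small_eq _ (fun n => (`|b%:~R| ^+ 2) ^+ (n ^ 3 * N n) * `|w%:~R| ^+ (n ^ 3 * N n))).
      by apply: smallM; apply: s7 => //; apply: exprn_ge0.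
    by move=> n; rewrite /wt normrM !normrX exprMn -!exprM mulnA.
  - apply: smallM; first exact: small_cst.
    apply: smallX; apply: smallM => //; apply: smallM.
      by apply: small_cst; apply: exprn_ge0.
    apply: (small_eq _ (fun n => (M ^+ 3) ^+ N n * (M ^+ 6) ^+ (n ^ 3 * N n) *
        n%:R ^+ (2 * n ^ 3 * N n))).
      by apply: smallM => //; apply: smallM; [apply: sN|apply: s7]; apply: exprn_ge0.
    by move=> n; rewrite exprMn -!exprM -exprD mulnDl mulnA.
  - apply: (small_eq _ (fun n => exp 1 ^+ (N n * N n) * (c1 ^+ (n ^ 3 * N n) *
        n%:R ^+ (3 * n ^ 3 * N n) * exp (`|lam| * c1) ^+ (n ^ 3 * N n)))).
      apply: smallM; first by apply: small_pow => // n _; rewrite pow8.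
      by apply: smallM; [apply: smallM => //; apply: s7 => //|apply: s7 => //].
    move=> n; have -> : exp (N n)%:R = exp 1 ^+ N n by rewrite expRX.
    rewrite -(mulnA 3) [in RHS](exprM n%:R 3); move: (n%:R ^+ 3) (n ^ 3)%N (N n) => T D Q.
    by rewrite !exprMn -!exprM.
have [n n0] := small_lt_natX _ sbound.
have -> : (n ^ 4)%N = N n by rewrite /N -expnSr.
by rewrite ltNge matrix_bound.
Qed.
End GelfondSchneider.

Lemma IZR_Z_of_int (p : int) : IZR (Z_of_int p) = p%:~R.
Proof. by rewrite IZR_intr Z_of_intK. Qed.

Lemma is_rationalP (x : R) :
  is_rational x <-> exists p q : int, q != 0 /\ x = p%:~R / q%:~R.
Proof.
split=> [[p [q [q0 ->]]]|[p [q [q0 ->]]]].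
  exists (int_of_Z p), (int_of_Z q); split; last by rewrite -!IZR_intr RdivE.
  by apply/eqP => e; apply: q0; rewrite -[LHS]int_of_ZK e.
exists (Z_of_int p), (Z_of_int q); split; last by rewrite !IZR_Z_of_int RdivE.
by move=> e; case/eqP: q0; rewrite -[LHS]Z_of_intK e.
Qed.

Lemma ln_eq0 (x : R) : 0 < x -> ln x = 0 -> x = 1.
Proof. by move=> /RltP x0 e; rewrite -(exp_ln x x0) e expR0. Qed.

Theorem fixed_point_rational (L : R) (k : nat) : 0 < L -> is_algebraic L -> (0 < k)%N ->
  is_rational (exp (ln L / L) ^+ k) -> is_rational L.
Proof.
move=> L0 Lalg k0 /is_rationalP[u [w [w0 Ek]]].
have [//|irr] := Classical_Prop.classic (is_rational L); exfalso.
have irrL (p q : int) : q != 0 -> q%:~R * L != p%:~R.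
  move=> q0; apply/eqP => e; apply/irr/is_rationalP; exists p, q; split=> //.
  by rewrite -e mulrC mulKf // intr_eq0.
(* This makes [lam = ln L / L] nonzero. *)
have L1 : L != 1.
  by have := irrL 1 1 isT; rewrite mul1r.
have [b [d [K [nu [b0 nu0 nuDM nuC nuL]]]]] := liouville L Lalg.
apply: (@gelfond_schneider_contradiction L (ln L / L) k u w b d K nu) => //.
- rewrite mulf_neq0 ?invr_eq0 ?(gt_eqF L0) //.
  by apply: contra_neq L1 => /(ln_eq0 L L0).
- by rewrite divfK ?(gt_eqF L0) // exp_ln //; apply/RltP.
- by rewrite -Ek expRX mulr_natr.
Qed.

(** * Counting integers coprime to k *)

(** With [u q = v t + 1], [(a^u)^t = (p^v)^t p]; hence [p^v] divides [a^u], and the quotient is the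
    root. *)
Lemma coprime_power_root (a p t q : nat) : (0 < q)%N -> (0 < p)%N -> coprime t q ->
  (a ^ t)%N = (p ^ q)%N -> exists m, p = (m ^ t)%N.
Proof.
move=> q0 p0 tq E; have [t0|t0] := posnP t.
  move: tq E; rewrite t0 /coprime gcd0n => /eqP -> /=.
  by rewrite expn0 expn1 => <-; exists 1%N.
have [u v Euv _] := egcdnP t q0.
have Eg : gcdn q t = 1%N by apply/eqP; rewrite -/(coprime q t) coprime_sym.
rewrite Eg in Euv.
have Ep : ((a ^ u) ^ t = (p ^ v) ^ t * p)%N.
  by rewrite -!expnM mulnC expnM E -expnM mulnC Euv addn1 expnSr.
have : (p ^ v %| a ^ u)%N by rewrite -(dvdn_pexp2r _ _ t0) Ep dvdn_mulr.
case/dvdnP => m Em; exists m.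
apply/eqP; rewrite -(@eqn_pmul2l ((p ^ v) ^ t)) ?expn_gt0 ?p0 //.
by rewrite -Ep Em expnMn mulnC.
Qed.

Lemma count_coprime_period (m j : nat) : count (coprime m) (iota 0 (j * m)) = (j * totient m)%N.
Proof.
elim: j => [//|j IH]; rewrite mulSn addnC iotaD count_cat IH add0n mulSn addnC.
congr addn; rewrite -[X in iota X _](addn0 (j * m)) iotaDl count_map.
rewrite totient_count_coprime -sum1_count big_mkcond /index_iota subn0.
by apply: eq_bigr => i _ /=; rewrite /coprime gcdnMDl; case: (_ == _).
Qed.

Lemma count_coprime_iota1 (m j : nat) : (0 < m)%N ->
  count (coprime m) (iota 1 (j * m)) = (j * totient m)%N.
Proof.
move=> m0; rewrite -count_coprime_period.
have : (count (coprime m) (iota 0 (j * m).+1) = count (coprime m) (iota 0 (j * m)) + coprime m (j * m))%N.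
  by rewrite -addn1 iotaD count_cat /= addn0.
rewrite /= (_ : coprime m (j * m) = coprime m 0); last by rewrite /coprime gcdnMl gcdn0.
lia.
Qed.

Lemma totient_expn (m t : nat) : (0 < t)%N -> totient (m ^ t) = (m ^ t.-1 * totient m)%N.
Proof.
case: t => // t _; have [-> //|m0] := posnP m.
  by rewrite exp0n // muln0.
rewrite -count_coprime_period -expnSr -[RHS](eq_count (a1 := coprime (m ^ t.+1))).
  by rewrite -[X in iota 0 X]mul1n count_coprime_period mul1n.
by move=> x; rewrite coprime_pexpl.
Qed.

Lemma totient_mul_le (k t : nat) : (totient (k * t) <= t * totient k)%N.
Proof.
rewrite -count_coprime_period -[X in (X <= _)%N]mul1n -count_coprime_period mul1n mulnC.
by apply: sub_count => x; rewrite coprimeMl => /andP[].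
Qed.

Definition sift (S : seq nat) (n : nat) := all (fun p => ~~ (p %| n)%N) S.

Lemma coprime_sift (k n : nat) : (0 < k)%N -> coprime k n = sift (primes k) n.
Proof.
move=> k0; apply/idP/allP => [kn p|H].
  rewrite mem_primes => /and3P[pp _ pk]; apply/negP => pn.
  have : (p %| gcdn k n)%N by rewrite dvdn_gcd pk.
  by rewrite (eqP kn) dvdn1 => /eqP e; move: pp; rewrite e.
apply/negPn/negP => ncop.
have g1 : (1 < gcdn k n)%N by rewrite ltn_neqAle eq_sym ncop gcdn_gt0 k0.
have := H (pdiv (gcdn k n)); rewrite mem_primes pdiv_prime // k0.
by rewrite !(dvdn_trans (pdiv_dvd _)) ?dvdn_gcdl ?dvdn_gcdr // => /(_ isT).
Qed.

Lemma count_iota1S (P : pred nat) (X : nat) :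
  count P (iota 1 X.+1) = (count P (iota 1 X) + P X.+1)%N.
Proof.
have -> : iota 1 X.+1 = iota 1 X ++ [:: X.+1] by rewrite -{1}(addn1 X) iotaD add1n.
by rewrite count_cat /= addn0.
Qed.

Lemma count_dvd (p X : nat) (P : pred nat) : (0 < p)%N ->
  count [pred n | (p %| n)%N & P n] (iota 1 X) = count (fun n => P (p * n)%N) (iota 1 (X %/ p)).
Proof.
move=> p0; elim: X => [|X IH]; first by rewrite div0n.
rewrite count_iota1S IH divnS //=.
have [pX|] := boolP (p %| X.+1)%N; last by rewrite addn0.
rewrite add1n count_iota1S /=; congr (_ + nat_of_bool (P _))%N.
by rewrite -[LHS](divnK pX) divnS // pX mulnC.
Qed.

(** Legendre's sieve, one prime at a time: the multiples of [p] among the sifted integers up to [X]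
    correspond to the sifted integers up to [X / p]. The error thus at most doubles, plus 1 for the
    rounding of [X / p]. *)
Lemma sift_count (S : seq nat) (X : nat) : uniq S -> all prime S ->
  `|(count (sift S) (iota 1 X))%:R - X%:R * \prod_(p <- S) (1 - p%:R^-1)| <= 2 ^+ size S - 1 :> R.
Proof.
elim: S X => [|p S IH] X /=.
  move=> _ _; rewrite big_nil mulr1 (eq_count (a2 := xpredT)) // count_predT size_iota.
  by rewrite !subrr normr0.
case/andP=> pS uS /andP[pp aS]; have p0 := prime_gt0 pp.
have Ec : (count (sift S) (iota 1 X) = count (sift (p :: S)) (iota 1 X) +
    count (sift S) (iota 1 (X %/ p)))%N.
  have -> : count (sift S) (iota 1 (X %/ p)) = count [pred n | (p %| n)%N & sift S n] (iota 1 X).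
    rewrite count_dvd //; apply: eq_in_count => n _; apply: eq_in_all => q qS.
    have pq : prime q := allP aS q qS.
    have np : (q == p) = false by apply/eqP => e; rewrite -e qS in pS.
    by rewrite (Euclid_dvdM _ _ pq) (dvdn_prime2 pq pp) np.
  rewrite -count_predUI [X in (_ = _ + X)%N](_ : _ = 0%N) ?addn0.
    by apply: eq_count => n /=; case: (p %| n)%N => /=; rewrite ?orbF.
  by rewrite (eq_count (a2 := pred0)) ?count_pred0 // => n /=; case: (p %| n)%N; rewrite ?andbF.
move/(congr1 (fun n : nat => n%:R : R)): Ec; rewrite natrD => /esym/(canRL (addrK _)) ->.
rewrite big_cons.
have h1 := IH X uS aS; have h2 := IH (X %/ p)%N uS aS.
set Pi := \prod_(_ <- _) _ in h1 h2 *.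
have Pi01 : 0 <= Pi <= 1.
  rewrite /Pi; elim: (S) aS => [|q s IHs] /=; first by rewrite big_nil ler01 lexx.
  case/andP=> pq /IHs; rewrite big_cons => /andP[a b].
  have q1 : 0 <= (1 - q%:R^-1 : R) <= 1.
    by rewrite subr_ge0 gerBl invr_ge0 ler0n andbT invf_le1 ?ltr0n ?ler1n prime_gt0.
  by case/andP: q1 => c e; rewrite mulr_ge0 //= mulr_ile1.
have Xp : 0 <= (X%:R : R) / p%:R - (X %/ p)%:R <= 1.
  have pR : 0 < p%:R :> R by rewrite ltr0n.
  rewrite subr_ge0 lerBlDr ler_pdivlMr // ler_pdivrMr // -natrM ler_nat leq_divM /=.
  by rewrite nat1r -natrM ler_nat ltnW // ltn_ceil.
set c1 := _%:R in h1 *; set c2 := _%:R in h2 *.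
have -> : c1 - c2 - X%:R * ((1 - p%:R^-1) * Pi) = (c1 - X%:R * Pi) - (c2 - (X %/ p)%:R * Pi)
    + (X%:R / p%:R - (X %/ p)%:R) * Pi by ring.
have h3 : `|(X%:R / p%:R - (X %/ p)%:R) * Pi| <= 1 :> R.
  case/andP: Xp => a b; case/andP: Pi01 => c e.
  by rewrite ger0_norm ?mulr_ge0 // mulr_ile1.
apply: le_trans (ler_normD _ _) _; apply: le_trans (lerD (ler_normB _ _) h3) _.
by rewrite exprS; lra.
Qed.

Lemma totient_prod (k : nat) : (0 < k)%N ->
  (totient k)%:R = k%:R * \prod_(p <- primes k) (1 - p%:R^-1) :> R.
Proof.
move=> k0.
have Ek : k%:R = \prod_(p <- primes k) p%:R ^+ logn p k :> R.
  rewrite {1}(prod_prime_decomp k0) prime_decompE big_map natr_prod.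
  by apply: eq_bigr => p _; rewrite natrX.
rewrite totientE // natr_prod [k%:R]Ek -big_split big_seq [RHS]big_seq /=.
apply: eq_bigr => p; rewrite mem_primes => /and3P[pp _ pk].
have p0 := prime_gt0 pp.
have l0 : (0 < logn p k)%N by rewrite logn_gt0 mem_primes pp k0.
rewrite natrM natrX -{2}(prednK l0) exprS mulrAC mulrBr mulr1 mulfV; last first.
  by rewrite pnatr_eq0 -lt0n.
by rewrite -subn1 natrB.
Qed.

(** Each prime divisor from 16 on pays for its own factor 16, as the product of the prime divisors
    is at most [k]; fewer than 16 primes lie below 16. The base 16 is [4^2], for
    [4^omega(k) = O(sqrt k)]. *)
Lemma omega_bound : exists2 C : R, 0 < C &
  forall k : nat, (0 < k)%N -> 16 ^+ size (primes k) <= C * k%:R.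
Proof.
exists (16 ^+ 16) => [|k k0]; first by rewrite exprn_gt0.
have rad : ((\prod_(p <- primes k) p)%N <= k)%N.
  rewrite {2}(prod_prime_decomp k0) prime_decompE big_map /= big_seq [leqRHS]big_seq.
  apply: leq_prod => p pk; rewrite -[X in (X <= _)%N]expn1 leq_pexp2l //.
    by move: pk; rewrite mem_primes => /andP[/prime_gt0].
  by rewrite logn_gt0.
have small : (count (fun p => p < 16)%N (primes k) <= 16)%N.
  rewrite -size_filter -[X in (_ <= X)%N](size_iota 0 16); apply: uniq_leq_size.
    by rewrite filter_uniq // primes_uniq.
  by move=> p; rewrite mem_filter mem_iota => /andP[].
have : 16 ^+ size (primes k) <= 16 ^+ count (fun p => p < 16)%N (primes k) *
    (\prod_(p <- primes k) p)%N%:R :> R.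
  have : all (leq 1) (primes k) by apply/allP => p; rewrite mem_primes => /andP[/prime_gt0].
  elim: (primes k) => [|p s IH] /=; first by rewrite big_nil mulr1.
  case/andP=> p0 /IH {}IH; rewrite big_cons exprS natrM.
  case: ltnP => p16; rewrite ?add1n ?exprS ?add0n.
    rewrite -mulrA ler_pM2l // (le_trans IH) // ler_wpM2l ?exprn_ge0 //.
    by rewrite ler_peMl // ler1n.
  by rewrite mulrCA ler_pM // ?exprn_ge0 // (ler_nat _ 16).
move/le_trans; apply; rewrite ler_pM ?exprn_ge0 ?ler_nat //.
by rewrite ler_weXn2l // ler1n.
Qed.

(** Each factor [1 - 1/p] is at least [1/2], so [k <= 2^omega(k) phi(k)]; combine with
    [4^omega(k) = O(sqrt k)]. This makes the sieve error [O(phi(k) / sqrt k)]. *)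
Lemma totient_lower_sqrt : exists2 C : R, 0 < C & forall k : nat, (0 < k)%N ->
  2 ^+ size (primes k) * Num.sqrt k%:R <= C * (totient k)%:R.
Proof.
have [C0 C0p HC] := omega_bound; exists (Num.sqrt C0) => [|k k0]; first by rewrite sqrtr_gt0.
set W : R := 2 ^+ size (primes k).
have W0 : 0 < W by rewrite exprn_gt0.
have kR : 0 < k%:R :> R by rewrite ltr0n.
have W2 : W ^+ 2 <= Num.sqrt C0 * Num.sqrt k%:R.
  have -> : W ^+ 2 = Num.sqrt (W ^+ 4).
    by rewrite (exprM W 2 2) sqrtr_sqr ger0_norm // exprn_ge0 // ltW.
  rewrite -sqrtrM ?(ltW C0p) // ler_wsqrtr // /W -exprM mulnC exprM.
  by rewrite (_ : 2 ^+ 4 = 16) ?HC // -natrX.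
have low : k%:R <= W * (totient k)%:R.
  rewrite totient_prod // mulrCA ler_peMr ?(ltW kR) //.
  rewrite /W; have : all prime (primes k) by apply/allP => p; rewrite mem_primes => /andP[].
  elim: (primes k) => [|p s IH] /=; first by rewrite big_nil mulr1.
  case/andP=> pp /IH {}IH; rewrite big_cons exprS mulrACA mulr_ege1 //.
  rewrite mulrBr mulr1 lerBrDr -lerBrDl ler_pdivrMr ?ltr0n ?prime_gt0 //.
  have : 2 <= p%:R :> R by rewrite (ler_nat _ 2) prime_gt1.
  lra.
have s0 : 0 < Num.sqrt k%:R :> R by rewrite sqrtr_gt0.
rewrite -(ler_pM2r W0) mulrAC -expr2; apply: (@le_trans _ _ (Num.sqrt C0 * k%:R)).
  by rewrite -[k%:R in leRHS]sqr_sqrtr ?(ltW kR) // expr2 mulrA ler_pM2r.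
by rewrite -mulrA ler_pM2l ?sqrtr_gt0 // mulrC.
Qed.

Lemma coprime_interval_count : exists2 C : R, 0 < C &
  forall (k X0 X1 : nat) (a b : R), (0 < k)%N -> (X0 <= X1)%N ->
  `|X0%:R - a * k%:R| <= 1 -> `|X1%:R - b * k%:R| <= 1 ->
  `|(count (coprime k) (iota X0.+1 (X1 - X0)))%:R - (b - a) * (totient k)%:R| <=
  C * (totient k)%:R / Num.sqrt k%:R.
Proof.
have [C C0 HC] := totient_lower_sqrt; exists (4 * C) => [|k X0 X1 a b k0 X01 Ha Hb].
  by rewrite mulr_gt0.
have -> : (count (coprime k) (iota X0.+1 (X1 - X0)))%:R =
    (count (sift (primes k)) (iota 1 X1))%:R - (count (sift (primes k)) (iota 1 X0))%:R :> R.
  rewrite -{2}(subnKC X01) iotaD count_cat natrD addrC addKr add1n.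
  by rewrite (eq_count (fun q => coprime_sift k q k0)).
have ap : all prime (primes k) by apply/allP => p; rewrite mem_primes => /andP[].
have h1 := sift_count _ X1 (primes_uniq k) ap.
have h0 := sift_count _ X0 (primes_uniq k) ap.
have := HC k k0; rewrite totient_prod //.
set Pi := \prod_(_ <- _) _ in h0 h1 *.
set W := 2 ^+ _ in h0 h1 *; set c1 := _%:R in h1 *; set c0 := _%:R in h0 *.
move=> low.
have W1 : 1 <= W by rewrite exprn_ege1 // (ler_nat _ 1).
have Pi01 : 0 <= Pi <= 1.
  rewrite /Pi; elim: (primes k) ap => [|q s IHs] /=; first by rewrite big_nil ler01 lexx.
  case/andP=> pq /IHs; rewrite big_cons => /andP[u v].
  have q1 : 0 <= (1 - q%:R^-1 : R) <= 1.
    by rewrite subr_ge0 gerBl invr_ge0 ler0n andbT invf_le1 ?ltr0n ?ler1n prime_gt0.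
  by case/andP: q1 => c e; rewrite mulr_ge0 //= mulr_ile1.
have s0 : 0 < Num.sqrt k%:R :> R by rewrite sqrtr_gt0 ltr0n.
(* Each of the two sieve errors is at most [W - 1], and each of the two rounding errors at most
   1. *)
apply: (@le_trans _ _ (4 * W)); last first.
  by rewrite ler_pdivlMr // -!mulrA ler_wpM2l.
have -> : c1 - c0 - (b - a) * (k%:R * Pi) = (c1 - X1%:R * Pi) - (c0 - X0%:R * Pi)
   + ((X1%:R - b * k%:R) * Pi - (X0%:R - a * k%:R) * Pi) by ring.
have hP y : `|y| <= 1 -> `|y * Pi| <= 1.
  move=> y1; case/andP: Pi01 => u v; rewrite normrM (ger0_norm u).
  by rewrite mulr_ile1.
have := hP _ Ha; have := hP _ Hb => hb ha.
apply: le_trans (ler_normD _ _) _.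
apply: le_trans (lerD (ler_normB _ _) (ler_normB _ _)) _.
lra.
Qed.

(** * Roots of perfect powers *)

(** [t^5 / 2^t] is largest at [t = 7], where it lies between [2^7] and [2^8]. *)
Lemma expn5_le (t : nat) : (t ^ 5 <= 2 ^ (t + 8))%N.
Proof.
have [t7|] := leqP t 7.
  by move: t t7; do 8![case=> [//|]].
elim: t => // t IH; rewrite ltnS leq_eqVlt => /predU1P[<- //|t7].
rewrite addSn (expnS 2); apply: (@leq_trans (2 * t ^ 5)); last by rewrite leq_mul // IH.
have : (7 * t ^ 4 <= t ^ 5)%N by rewrite (expnS t 4) leq_mul // ltnW.
have : (7 * t ^ 3 <= t ^ 4)%N by rewrite (expnS t 3) leq_mul // ltnW.
have : (7 * t ^ 2 <= t ^ 3)%N by rewrite (expnS t 2) leq_mul // ltnW.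
have : (7 * t <= t ^ 2)%N by rewrite (expnS t 1) leq_mul // ltnW.
have -> : (t.+1 ^ 5 = t ^ 5 + 5 * t ^ 4 + 10 * t ^ 3 + 10 * t ^ 2 + 5 * t + 1)%N.
  by rewrite -addn1; lia.
lia.
Qed.

(** From [r >= 2], [r^2 t^5 <= r^2 2^(t+8) = 1024 r^2 2^(t-2) <= 1024 r^t <= 1024 k t], and
    [32^2 = 1024]. The decay in [t] makes the sum over all exponents converge. *)
Lemma perfect_power_base_bound (k t r : nat) : (1 < t)%N -> (1 < r)%N -> (r ^ t <= k * t)%N ->
  r%:R <= 32 * Num.sqrt k%:R / t%:R ^+ 2 :> R.
Proof.
move=> t1 r1 rt.
have H : (r ^ 2 * t ^ 4 <= 1024 * k)%N.
  rewrite -(@leq_pmul2r t) ?(ltnW t1) // -mulnA -expnSr -(mulnA 1024).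
  apply: (@leq_trans (1024 * r ^ t)); last by rewrite leq_mul2l.
  apply: (@leq_trans (r ^ 2 * 2 ^ (t + 8))); first by rewrite leq_mul2l expn5_le orbT.
  rewrite -{2}(subnKC t1) (expnD r) mulnCA leq_mul2l; apply/orP; right.
  rewrite -{1}(subnKC t1) addnC addnA expnD (_ : 2 ^ (8 + 2) = 1024)%N // leq_mul2l /=.
  by case: (t - 2)%N => // e; rewrite leq_exp2r.
have t0 : 0 < t%:R ^+ 2 :> R by rewrite exprn_gt0 // ltr0n ltnW.
rewrite ler_pdivlMr // -(@ler_pXn2r _ 2) ?nnegrE ?mulr_ge0 ?exprn_ge0 ?sqrtr_ge0 //.
rewrite exprMn [leRHS]exprMn sqr_sqrtr // -exprM (_ : 32 ^+ 2 = 1024%:R); last by rewrite -natrX.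
by move: H; rewrite -(ler_nat R) natrM [leRHS]natrM (natrX _ r) (natrX _ t).
Qed.

(* [0] when [n] is not a [t]-th power. *)
Definition root_of (t n : nat) : nat := (\max_(m < n.+1 | m ^ t == n) m)%N.

Lemma root_ofE (t m : nat) : (0 < t)%N -> root_of t (m ^ t) = m.
Proof.
move=> t0; have mt : (m < (m ^ t).+1)%N.
  rewrite ltnS; case: m => // m; by rewrite -[X in (X <= _)%N]expn1 leq_pexp2l.
apply/eqP; rewrite eqn_leq; apply/andP; split.
  by apply/bigmax_leqP => i /eqP/eqP; rewrite eqn_exp2r // => /eqP ->.
exact: (@leq_bigmax_cond _ _ _ (Ordinal mt)).
Qed.

Lemma root_of_exp (t n : nat) : root_of t n != 0%N -> (root_of t n ^ t)%N = n.
Proof.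
rewrite /root_of; elim/big_rec: _ => [//|i m /eqP it IH].
by rewrite /maxn; case: ifP.
Qed.

(** The limit [3 r] comes from [ratio_power_le]; it spans three full periods, so the count is
    exact. *)
Definition coprime_below (r : nat) : seq nat := [seq l <- iota 1 (3 * r) | coprime r l].

Lemma size_coprime_below (r : nat) : size (coprime_below r) = (3 * totient r)%N.
Proof.
rewrite size_filter; have [->//|r0] := posnP r.
exact: count_coprime_iota1.
Qed.

Lemma sum_inv_sqr_le (T : nat) : \sum_(t <- iota 2 T) (t%:R ^+ 2)^-1 <= 1 :> R.
Proof.
suff : \sum_(t <- iota 2 T) (t%:R ^+ 2)^-1 <= 1 - T.+1%:R^-1 :> R.
  by move/le_trans; apply; rewrite gerBl invr_ge0.
elim: T => [|T IH]; first by rewrite big_nil invr1 subrr.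
rewrite -{1}(addn1 T) iotaD big_cat /= big_cons big_nil addr0.
apply: le_trans (lerD IH (lexx _)) _; rewrite add2n.
have p1 : 0 < T.+1%:R :> R by rewrite ltr0n.
have -> : T.+2%:R = T.+1%:R + 1 :> R by rewrite natr1.
move: p1; move: (T.+1%:R : R) => x x0.
have x1 : 0 < x + 1 by lra.
rewrite -subr_ge0.
have -> : 1 - (x + 1)^-1 - (1 - x^-1 + ((x + 1) ^+ 2)^-1) = (x * (x + 1) ^+ 2)^-1.
  by field; rewrite !gt_eqF.
by rewrite invr_ge0 mulr_ge0 ?exprn_ge0 ?(ltW x0) ?(ltW x1).
Qed.

(** Serves both [n t = k t] and [n t = k]. Each exponent with a root [r] contributes
    [3 phi(r) <= 3 r phi(k) / k], where [r <= 32 sqrt k / t^2]; this gives [96 = 3 * 32], the sum of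
    [1 / t^2] being at most 1. *)
Lemma perfect_power_sum (k T : nat) (n : nat -> nat) : (0 < k)%N ->
  (forall t, (1 < t)%N -> (1 < n t <= k * t)%N) ->
  (forall t r, (1 < t)%N -> (r ^ t)%N = n t -> (k * totient r <= r * totient k)%N) ->
  (size (flatten [seq coprime_below (root_of t (n t)) | t <- iota 2 T]))%:R <=
  96 * (totient k)%:R / Num.sqrt k%:R :> R.
Proof.
move=> k0 Hn Ht; rewrite size_flatten sumnE big_map big_map natr_sum.
have s0 : 0 < Num.sqrt k%:R :> R by rewrite sqrtr_gt0 ltr0n.
have c0 : 0 <= 96 * (totient k)%:R / Num.sqrt k%:R :> R.
  by rewrite divr_ge0 ?mulr_ge0 // ltW.
rewrite -[leRHS]mulr1; apply: le_trans (ler_wpM2l c0 (sum_inv_sqr_le T)).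
rewrite mulr_sumr big_seq [leRHS]big_seq; apply: ler_sum => t.
rewrite mem_iota => /andP[t1 _]; rewrite size_coprime_below.
set r := root_of t (n t).
have [->|r0] := eqVneq r 0%N.
  by rewrite mulr_ge0 // invr_ge0 exprn_ge0.
have rt : (r ^ t)%N = n t := root_of_exp _ _ r0.
have /andP[n1 nk] := Hn t t1.
have r1 : (1 < r)%N.
  by case: (r) r0 rt => [|[|r']] //; rewrite exp1n => _ e; rewrite -e in n1.
have B : r%:R <= 32 * Num.sqrt k%:R / t%:R ^+ 2 :> R.
  by apply: perfect_power_base_bound => //; rewrite rt.
have kR : 0 < k%:R :> R by rewrite ltr0n.
rewrite natrM -(ler_pM2l kR) mulrCA.
apply: (@le_trans _ _ (3 * ((32 * Num.sqrt k%:R / t%:R ^+ 2) * (totient k)%:R))).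
  rewrite ler_wpM2l //; apply: (@le_trans _ _ (r%:R * (totient k)%:R)).
    by rewrite -!natrM ler_nat (Ht t).
  by rewrite ler_wpM2r.
rewrite le_eqVlt; apply/orP; left; apply/eqP.
have x0 : t%:R != 0 :> R by rewrite pnatr_eq0; case: (t) t1.
have := sqr_sqrtr (ltW kR); move: s0 => /gt_eqF /negbT.
move: (Num.sqrt _) (t%:R : R) x0 => s x x0 s0 <-.
by field; rewrite s0 x0.
Qed.

(** * Numbers of order k *)

Lemma is_rational_ratr (x : R) : is_rational x <-> exists r : rat, x = ratr r.
Proof.
rewrite is_rationalP; split=> [[p [q [q0 ->]]]|[r ->]].
  by exists (p%:~R / q%:~R)%R; rewrite fmorph_div /= !ratr_int.
by exists (numq r), (denq r).
Qed.

Lemma pos_rational (x : R) : 0 < x -> is_rational x ->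
  exists a c : nat, [/\ (0 < a)%N, (0 < c)%N, coprime a c & x = a%:R / c%:R].
Proof.
move=> x0 /is_rational_ratr[r Ex]; exists `|numq r|%N, `|denq r|%N.
have r0 : 0 < numq r by move: x0; rewrite Ex ltr0q numq_gt0.
split; rewrite ?absz_gt0 ?denq_neq0 ?gt_eqF ?coprime_num_den //.
by rewrite Ex /ratr !pmulrn !gez0_abs ?(ltW r0) // ltW // denq_gt0.
Qed.

Lemma is_algebraic_of_int_eval (P : {poly int}) (x : R) :
  P != 0 -> int_eval P x = 0 -> is_algebraic x.
Proof.
move=> P0 Px; exists (map Z_of_int P); split.
  have sP : ((size P).-1 < size P)%N by rewrite prednK // size_poly_gt0.
  exists (Z_of_int (lead_coef P)); split.
    apply: List.in_map; rewrite lead_coefE; move: sP; move: (size P).-1 => n.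
    elim: (polyseq P) n => [|c s IH] [|n] //= ns; first by left.
    by right; apply: IH.
  move=> e; have : lead_coef P = 0 by rewrite -[LHS]Z_of_intK e.
  by move/eqP; rewrite lead_coef_eq0 (negbTE P0).
apply: etrans Px; rewrite -{2}[P]polyseqK /int_eval.
elim: (polyseq P) => [|c s IH] /=; first by rewrite rmorph0 horner0.
rewrite cons_poly_def rmorphD rmorphM /= map_polyC map_polyX hornerD hornerM -IH.
by rewrite hornerX hornerC /= -IZR_Z_of_int addrC mulrC.
Qed.

Lemma is_algebraic_root (x : R) (n : nat) : (0 < n)%N -> is_rational (x ^+ n) -> is_algebraic x.
Proof.
move=> n0 /is_rationalP[a [c [c0 E]]].
apply: (@is_algebraic_of_int_eval (c%:P * 'X ^+ n - a%:P)).
  apply/negP => /eqP/(congr1 (fun q : {poly int} => q`_n)).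
  rewrite coefB coefCM coefXn eqxx mulr1 coefC (gtn_eqF n0) subr0 coef0 => e.
  by rewrite e eqxx in c0.
rewrite -[- a%:P]polyCN int_evalD int_evalM int_evalXn !int_evalC int_evalX E.
by rewrite rmorphN /= mulrC divfK ?subrr // intr_eq0.
Qed.

(** The number [(p / q)^(q / p)], whose tower converges to [p / q] when [p / q] lies in
    [[1/e, e]]. *)
Definition tower_base (p q : nat) : R := exp (ln (p%:R / q%:R)%R / (p%:R / q%:R)).

Lemma tower_base_gt0 (p q : nat) : 0 < tower_base p q.
Proof. exact: exp_gt0. Qed.

Lemma tower_baseX (p q : nat) : (0 < p)%N -> (0 < q)%N ->
  tower_base p q ^+ p = (p%:R / q%:R) ^+ q.
Proof.
move=> p0 q0; have pR : 0 < p%:R :> R by rewrite ltr0n.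
have qR : 0 < q%:R :> R by rewrite ltr0n.
have x0 : 0 < p%:R / q%:R :> R by rewrite divr_gt0.
rewrite -(exp_ln (p%:R / q%:R)%R); last exact/RltP.
rewrite /tower_base !expRX; congr exp.
rewrite -[LHS]mulr_natr -[RHS]mulr_natr; field.
by rewrite !gt_eqF.
Qed.

Lemma is_rational_tower_baseX (p q : nat) : (0 < p)%N -> (0 < q)%N ->
  is_rational (tower_base p q ^+ p).
Proof.
move=> p0 q0; rewrite tower_baseX //; apply/is_rational_ratr.
by exists ((p%:R / q%:R) ^+ q)%R; rewrite rmorphXn /= fmorph_div /= !ratr_nat.
Qed.

(** [A^p = (p / q)^q] is rational, so [p = k t]. If [A^k = a / c] in lowest terms, then [a^t = p^q]
    and [c^t = q^q]; as [t] divides [p], it is coprime to [q], and [coprime_power_root] applies to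
    both. *)
Lemma ord_tower_base (p q k : nat) : (0 < p)%N -> (0 < q)%N -> coprime p q ->
  ord_eq (tower_base p q) k ->
  exists t m l : nat, [/\ (0 < t)%N, p = (k * t)%N, p = (m ^ t)%N & q = (l ^ t)%N].
Proof.
move=> p0 q0 pq [/ssrnat.leP k0 [Hk Hmin]].
set A := tower_base p q in Hk Hmin; have A0 : 0 < A := tower_base_gt0 p q.
rewrite RpowE in Hk.
have [r Er] : exists r : rat, A ^+ k = ratr r by apply/is_rational_ratr.
have [r' Er'] : exists r : rat, A ^+ p = ratr r.
  exact/is_rational_ratr/is_rational_tower_baseX.
have kp : (k %| p)%N.
  apply/negPn/negP => ndv; have m0 : (0 < p %% k)%N by rewrite lt0n.
  apply: (Hmin (p %% k)%N); [exact/ssrnat.leP|by apply/ssrnat.ltP; rewrite ltn_mod|].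
  rewrite RpowE; apply/is_rational_ratr; exists (r' / r ^+ (p %/ k)).
  have E : A ^+ p = (A ^+ k) ^+ (p %/ k) * A ^+ (p %% k).
    by rewrite -exprM -exprD mulnC -divn_eq.
  by rewrite fmorph_div rmorphXn /= -Er -Er' E mulrC mulKf // !expf_neq0 // gt_eqF.
have Ep : p = (k * (p %/ k))%N by rewrite mulnC divnK.
set t := (p %/ k)%N in Ep.
have t0 : (0 < t)%N by move: p0; rewrite Ep muln_gt0 => /andP[].
have [a [c [a0 c0 ac Eac]]] := pos_rational (A ^+ k) (exprn_gt0 _ A0) Hk.
have E : (a ^ t * q ^ q = p ^ q * c ^ t)%N.
  apply/eqP; rewrite -(eqr_nat R) !natrM !natrX; apply/eqP.
  have := tower_baseX p q p0 q0; rewrite -/A {1}Ep exprM Eac !expr_div_n => /eqP.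
  by rewrite eqr_div ?expf_neq0 ?pnatr_eq0 -?lt0n // => /eqP.
have E1 : (a ^ t = p ^ q)%N.
  apply/eqP; rewrite eqn_dvd; apply/andP; split.
    by rewrite -(@Gauss_dvdl _ _ (c ^ t)) ?coprimeXl ?coprimeXr // -E dvdn_mulr.
  by rewrite -(@Gauss_dvdl _ _ (q ^ q)) ?coprimeXl ?coprimeXr // E dvdn_mulr.
have E2 : (c ^ t = q ^ q)%N.
  by apply/eqP; rewrite -(@eqn_pmul2l (p ^ q)) ?expn_gt0 ?p0 // -E E1.
have tq : coprime t q by apply: coprime_dvdl pq; rewrite Ep dvdn_mull.
have [m Em] := coprime_power_root a p t q q0 p0 tq E1.
have [l El] := coprime_power_root c q t q q0 q0 tq E2.
by exists t, m, l.
Qed.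

Lemma ord_exists (A : R) (n : nat) : (0 < n)%N -> is_rational (A ^+ n) ->
  exists2 k, (k <= n)%N & ord_eq A k.
Proof.
elim: n {-2}n (leqnn n) => [[] //|N IH] n nN n0 rn.
have [[m [m0 mn rm]]|H] := Classical_Prop.classic
  (exists m, [/\ (0 < m)%N, (m < n)%N & is_rational (A ^+ m)]).
  have [|k km ok] := IH m _ m0 rm; first by rewrite -ltnS (leq_trans mn).
  by exists k => //; rewrite (leq_trans km) // ltnW.
exists n => //; split; first exact/ssrnat.leP.
split; first by rewrite RpowE.
move=> m /ssrnat.leP m0 /ssrnat.ltP mn rm; apply: H; exists m; split=> //.
by rewrite RpowE in rm.
Qed.

Lemma Qset_tower_base (k : nat) (A : R) : Qset k A ->
  exists t m l : nat,
    [/\ (0 < t)%N, (k * t = m ^ t)%N, (0 < l)%N, coprime m l &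
        exp (-1) <= (m ^ t)%:R / (l ^ t)%:R <= exp 1] /\ A = tower_base (m ^ t) (l ^ t).
Proof.
move=> [_ [rg [[L [cvL algL]] ok]]].
have [Lrg EA] := tower_limit_range A L rg cvL.
have L0 : 0 < L.
  by have [+ _] := Lrg => /RleP; apply: lt_le_trans; apply: exp_gt0.
have [/ssrnat.leP k0 [rk _]] := ok.
have rL : is_rational L.
  by apply: (fixed_point_rational L k) => //; rewrite -RdivE -EA -RpowE.
have [p [q [p0 q0 pq EL]]] := pos_rational L L0 rL.
have EA' : A = tower_base p q by rewrite EA /tower_base -EL RdivE.
rewrite EA' in ok.
have [t [m [l [t0 Ep Em El]]]] := ord_tower_base p q k p0 q0 pq ok.
exists t, m, l; rewrite -Em -El -EL; split=> //; split=> //.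
- by rewrite lt0n; apply: contraTneq q0 => l0; rewrite El l0 exp0n.
- by move: pq; rewrite Em El coprime_pexpl // coprime_pexpr.
- by have [/RleP -> /RleP ->] := Lrg.
Qed.

(** The order [k'] exists since the [k]-th power is rational, and [ord_tower_base] gives [k = k' t]:
    either [t = 1] and the order is [k], or [k] and [q] are [t]-th powers. *)
Lemma tower_base_Qset (k q : nat) : (0 < k)%N -> (0 < q)%N -> coprime k q ->
  exp (-1) <= k%:R / q%:R <= exp 1 ->
  Qset k (tower_base k q) \/
  exists t m l : nat, [/\ (1 < t)%N, k = (m ^ t)%N & q = (l ^ t)%N].
Proof.
move=> k0 q0 kq /andP[lo hi].
have x0 : 0 < k%:R / q%:R :> R by rewrite divr_gt0 ?ltr0n.
have rk := is_rational_tower_baseX k q k0 q0.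
have [k' k'k ok] := ord_exists _ _ k0 rk.
have [t [m [l [t0 Ek Em El]]]] := ord_tower_base k q k' k0 q0 kq ok.
have [t1|t1] := ltnP 1 t; first by right; exists t, m, l.
left; have {}Ek : k' = k by rewrite Ek (_ : t = 1%N) ?muln1 //; apply/eqP; rewrite eqn_leq t1.
have [rg cv] := tower_cv (k%:R / q%:R)%R (conj (elimT RleP lo) (elimT RleP hi)).
split; first exact: is_algebraic_root k0 rk.
split; first by rewrite /tower_base -RdivE.
split; last by rewrite -Ek in ok *.
exists (k%:R / q%:R)%R; split; first by rewrite /tower_base -RdivE.
apply: (is_algebraic_root _ 1) => //; rewrite expr1; apply/is_rational_ratr.
by exists (k%:R / q%:R)%R; rewrite fmorph_div /= !ratr_nat.
Qed.

Lemma tower_base_inj (p q p' q' : nat) : (0 < p)%N -> (0 < q)%N -> (0 < p')%N -> (0 < q')%N ->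
  p%:R / q%:R <= exp 1 :> R -> p'%:R / q'%:R <= exp 1 :> R ->
  tower_base p q = tower_base p' q' -> p%:R / q%:R = p'%:R / q'%:R :> R.
Proof.
move=> p0 q0 p'0 q'0 /RleP h /RleP h' /exp_inv E.
by apply: ln_div_inj => //; apply/RltP; rewrite divr_gt0 ?ltr0n.
Qed.

(** * The count *)

Lemma dvdnP_Nat (d n : nat) : (d %| n)%N <-> Nat.divide d n.
Proof. by split=> [/dvdnP[q ->]|[q ->]]; [exists q|apply: dvdn_mull]. Qed.

Lemma gcd_gcdn (m n : nat) : Nat.gcd m n = gcdn m n.
Proof.
apply/eqP; rewrite eqn_dvd dvdn_gcd; apply/andP; split.
  by apply/andP; split; apply/dvdnP_Nat; [apply: Nat.gcd_divide_l|apply: Nat.gcd_divide_r].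
by apply/dvdnP_Nat; apply: Nat.gcd_greatest; apply/dvdnP_Nat; [apply: dvdn_gcdl|apply: dvdn_gcdr].
Qed.

Lemma totient_totient (k : nat) : (0 < k)%N -> Defs.totient k = prime.totient k.
Proof.
move=> k0; rewrite -[RHS]mul1n -count_coprime_iota1 // mul1n -size_filter /Defs.totient.
have -> : forall m n, List.seq m n = iota m n by move=> m n; elim: n m => //= n IH m; rewrite IH.
elim: (iota 1 k) => //= q s IH.
rewrite gcd_gcdn (_ : Nat.eqb _ _ = coprime k q).
  by case: ifP => //= _; rewrite IH.
by rewrite /coprime gcdnC; apply/PeanoNat.Nat.eqb_spec/eqP.
Qed.

(** [(5/6)^6] is just above [1/3]; 6 is the least [n] for which [(1 - 1/n)^n] is. *)
Lemma exp_m1_gt3 : 3^-1 < exp (-1).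
Proof.
have h : 1 - 6^-1 <= exp (- 6^-1).
  have n6 : - 6^-1 <> 0 :> R by lra.
  by apply/ltW/RltP; apply: exp_ineq1 n6.
have -> : exp (-1) = exp (- 6^-1) ^+ 6.
  by rewrite expRX; congr exp; lra.
apply: (@lt_le_trans _ _ ((1 - 6^-1) ^+ 6)); last first.
  apply: lerXn2r => //; rewrite nnegrE; first lra.
  by rewrite ltW // exp_gt0.
lra.
Qed.

Lemma exp_m1E : exp (-1) = (exp 1)^-1.
Proof. exact: exp_m1. Qed.

Lemma floor_exists (y : R) : 0 <= y -> exists n : nat, n%:R <= y < n.+1%:R.
Proof. by move=> y0; exists (Num.truncn y); apply: truncn_itv. Qed.

Lemma ceil_pred_exists (y : R) : 0 < y -> exists n : nat, n%:R < y <= n.+1%:R.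
Proof.
move=> y0; have [n /andP[ny yn]] := floor_exists y (ltW y0).
have [e|ne] := eqVneq n%:R y; last by exists n; rewrite lt_neqAle ne ny ltW.
case: n ny e {yn} => [|n] ny e; first by rewrite -e ltxx in y0.
by exists n; rewrite -e lexx ltr_nat ltnSn.
Qed.

(** Candidates with exponent [t >= 2]. An exponent for which [n t] is not a [t]-th power has root 0
    and contributes nothing. *)
Definition power_values (f : nat -> nat -> R) (n : nat -> nat) (T : nat) : seq R :=
  flatten [seq [seq f t l | l <- coprime_below (root_of t (n t))] | t <- iota 2 T].

Lemma size_power_values (f : nat -> nat -> R) (n : nat -> nat) (T : nat) :
  size (power_values f n T) =
  size (flatten [seq coprime_below (root_of t (n t)) | t <- iota 2 T]).
Proof.
rewrite !size_flatten /shape -!map_comp; congr sumn; apply: eq_map => t /=.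
by rewrite size_map.
Qed.

Lemma mem_power_values (f : nat -> nat -> R) (n : nat -> nat) (T t m l : nat) :
  (1 < t < 2 + T)%N -> (m ^ t)%N = n t -> (0 < l <= 3 * m)%N -> coprime m l ->
  f t l \in power_values f n T.
Proof.
move=> tT E lm ml; apply/flatten_mapP; exists t; first by rewrite mem_iota.
apply: map_f; rewrite -E root_ofE; last by case: (t) tT.
by rewrite mem_filter ml mem_iota add1n ltnS.
Qed.

(** Keeps the list of exponents finite: [t >= k + 7] would give [2^t <= m^t <= k t <= t^2 < 2^t]. *)
Lemma exponent_lt (k t m : nat) : (1 < k)%N -> (1 < t)%N -> (m ^ t <= k * t)%N ->
  (1 < m)%N -> (t < 2 + (k + 5))%N.
Proof.
move=> k1 t1 mt m1; rewrite ltnNge; apply/negP => kt.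
have : (2 ^ t <= k * t)%N by apply: leq_trans mt; rewrite leq_exp2r // ltnW.
rewrite leqNgt => /negP; apply; apply: (@leq_ltn_trans (t * t)).
  by rewrite leq_mul2r; apply/orP; right; apply: leq_trans kt; lia.
have: (5 <= t)%N by lia.
move: (t); elim=> // n IH; rewrite ltnS leq_eqVlt => /predU1P[<- //|n5].
by have := IH n5; rewrite expnS; nia.
Qed.

Lemma ratio_power_le (m l t : nat) : (0 < t)%N -> (0 < l)%N ->
  exp (-1) <= (m ^ t)%:R / (l ^ t)%:R -> (l <= 3 * m)%N.
Proof.
move=> t0 l0 h; have lt0 : 0 < (l ^ t)%:R :> R by rewrite ltr0n expn_gt0 l0.
rewrite -(leq_exp2r _ _ t0) expnMn.
apply: (@leq_trans (3 * m ^ t)); last by rewrite leq_mul2r -[X in (X <= _)%N](expn1 3) leq_pexp2l ?orbT.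
rewrite -(ler_nat R) natrM.
have := lt_le_trans exp_m1_gt3 h; rewrite ltr_pdivlMr // => H.
by apply/ltW; rewrite -ltr_pdivrMl.
Qed.

(** [phi(r) / r = phi(r^t) / r^t = phi(k t) / (k t) <= phi(k) / k]. *)
Lemma totient_power_base_le (k t r : nat) : (1 < t)%N -> (r ^ t = k * t)%N ->
  (k * prime.totient r <= r * prime.totient k)%N.
Proof.
move=> t1 E; rewrite -(@leq_pmul2r t) ?(ltnW t1) // mulnAC -E.
rewrite -{1}(prednK (ltnW t1)) expnS -!mulnA leq_mul2l; apply/orP; right.
rewrite -totient_expn ?(ltnW t1) // E [leqRHS]mulnC; exact: totient_mul_le.
Qed.

Lemma totient_perfect_power (t r : nat) : (1 < t)%N ->
  (r ^ t * prime.totient r = r * prime.totient (r ^ t))%N.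
Proof.
by move=> t1; rewrite totient_expn ?(ltnW t1) // -{1}(prednK (ltnW t1)) expnS mulnA.
Qed.

Lemma Qset_count : exists2 C : R, 0 < C & forall k : nat, (2 < k)%N ->
  exists s : seq R, [/\ uniq s, forall A, (A \in s) <-> Qset k A &
    `|(size s)%:R / (prime.totient k)%:R - (exp 1 - (exp 1)^-1)| <= C / Num.sqrt k%:R].
Proof.
have [C C0 HC] := coprime_interval_count.
exists (C + 96) => [|k k2]; first by rewrite addr_gt0.
have e0 : 0 < exp 1 := exp_gt0 1.
have k0 : (0 < k)%N by apply: leq_trans k2.
have k1 : (1 < k)%N by apply: leq_trans k2.
have kR : 0 < k%:R :> R by rewrite ltr0n.
(* [X1] is the floor of [e k] and [X0] is one less than the ceiling of [k / e], so the integers of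
   [[k / e, e k]] are those from [X0 + 1] to [X1]. *)
have [X1 /andP[X1k kX1]] := floor_exists (exp 1 * k%:R)%R (mulr_ge0 (ltW e0) (ltW kR)).
have [X0 /andP[X0k kX0]] := ceil_pred_exists ((exp 1)^-1 * k%:R)%R (mulr_gt0 (etrans (invr_gt0 _) e0) kR).
have e1 : 1 < exp 1 by apply/RltP/exp1_gt1.
have X01 : (X0 <= X1)%N.
  rewrite -ltnS -(ltr_nat R); apply: lt_trans X0k (le_lt_trans _ kX1).
  by rewrite ler_pM2r // (le_trans (ltW (_ : _ < 1))) ?invf_lt1 // ltW.
have inX q : (q \in iota X0.+1 (X1 - X0)) = (0 < q)%N && (exp (-1) <= k%:R / q%:R <= exp 1).
  rewrite mem_iota addSn subnKC // ltnS; case: (posnP q) => [-> //|q0] /=.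
  have qR : 0 < q%:R :> R by rewrite ltr0n.
  have -> : (exp (-1) <= k%:R / q%:R) = (q%:R <= exp 1 * k%:R).
    by rewrite exp_m1E ler_pdivlMr // ler_pdivrMl.
  have -> : (k%:R / q%:R <= exp 1) = ((exp 1)^-1 * k%:R <= q%:R).
    by rewrite ler_pdivrMr // ler_pdivrMl.
  apply/andP/andP => -[h1 h2]; split.
  - by apply: le_trans X1k; rewrite ler_nat.
  - by apply: (le_trans kX0); rewrite ler_nat.
  - by rewrite -(ltr_nat R) (lt_le_trans X0k).
  - by rewrite -ltnS -(ltr_nat R) (le_lt_trans h1).
(* [main] holds the candidates with [t = 1], [ext] those with [t > 1], and [bad] covers the members
   of [main] whose order may be smaller than [k]. Hence [Q(k)] lies between [#main - #bad] and
   [#main + #ext]. *)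
pose main := [seq tower_base k q | q <- [seq q <- iota X0.+1 (X1 - X0) | coprime k q]].
pose ext := power_values (fun t l => tower_base (k * t) (l ^ t)) (fun t => (k * t)%N) (k + 5).
pose bad := power_values (fun t l => tower_base k (l ^ t)) (fun=> k) (k + 5).
(* [ext] may repeat values or contain numbers outside [Qset k], hence the filter and [undup]. *)
pose s := undup [seq A <- main ++ ext | `[< Qset k A >]].
have ext_size : (size ext)%:R <= 96 * (prime.totient k)%:R / Num.sqrt k%:R :> R.
  rewrite size_power_values; apply: perfect_power_sum => // t.
    by move=> t1; rewrite leqnn andbT (leq_trans k1) // leq_pmulr // ltnW.
  by move=> r t1 E; apply: totient_power_base_le t1 E.
have bad_size : (size bad)%:R <= 96 * (prime.totient k)%:R / Num.sqrt k%:R :> R.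
  rewrite size_power_values; apply: perfect_power_sum => // t.
    by move=> t1; rewrite k1 leq_pmulr // ltnW.
  by move=> r t1 E; rewrite -E totient_perfect_power.
have main_size : `|(size main)%:R - (exp 1 - (exp 1)^-1) * (prime.totient k)%:R| <=
    C * (prime.totient k)%:R / Num.sqrt k%:R.
  rewrite size_map size_filter; apply: HC => //; rewrite ler_norml.
    by move: X0k kX0; rewrite -natr1; lra.
  by move: X1k kX1; rewrite -natr1; lra.
have sP A : A \in s <-> Qset k A.
  rewrite mem_undup mem_filter; split; first by case/andP=> /asboolP.
  move=> QA; apply/andP; split; first exact/asboolP.
  have [t [m [l [[t0 Et l0 ml rg] EA]]]] := Qset_tower_base k A QA.
  rewrite mem_cat; have [t1|t1] := ltnP 1 t.
    apply/orP; right; rewrite EA -Et.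
    have m1 : (1 < m)%N.
      rewrite ltnNge; apply/negP => m1; have : (m ^ t <= 1)%N by case: (m) m1 => [|[]] //; rewrite ?exp1n ?exp0n.
      by rewrite -Et leqNgt (leq_trans k1) // leq_pmulr.
    apply: (@mem_power_values (fun t l => tower_base (k * t) (l ^ t)) _ _ t m l) => //.
      by rewrite t1 (exponent_lt k t m) // Et.
    by rewrite l0; apply: (ratio_power_le m l t) => //; case/andP: rg.
  have {t0 t1} Et1 : t = 1%N by apply/eqP; rewrite eqn_leq t1.
  move: Et rg EA; rewrite Et1 !expn1 muln1 => Em rg EA; rewrite -Em in ml rg EA.
  by apply/orP; left; rewrite EA; apply: map_f; rewrite mem_filter ml inX l0.
exists s; split=> //; first exact: undup_uniq.
(* The lower bound [lo] needs distinct values: distinct [q] give distinct [k / q <= e], where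
   [x^(1/x)] is injective. *)
have main_uniq : uniq main.
  rewrite map_inj_in_uniq; first by rewrite filter_uniq // iota_uniq.
  move=> q q'; rewrite !mem_filter !inX => /and3P[_ q0 /andP[_ qe]] /and3P[_ q'0 /andP[_ q'e]].
  move/tower_base_inj => /(_ k0 q0 k0 q'0 qe q'e) E.
  have := mulfI (negbT (gt_eqF kR)) E.
  move/invr_inj/eqP; by rewrite eqr_nat => /eqP.
have up : (size s <= size main + size ext)%N.
  rewrite (leq_trans (size_undup _)) // size_filter (leq_trans (count_size _ _)) //.
  by rewrite size_cat.
have lo : (size main <= size s + size bad)%N.
  rewrite -size_cat; apply: uniq_leq_size => // A /mapP[q]; rewrite mem_filter inX.
  case/and3P=> kq q0 rg ->; rewrite mem_cat.
  have [Q|[t [m [l [t1 Ek Eq]]]]] := tower_base_Qset k q k0 q0 kq rg.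
    by apply/orP; left; apply/sP.
  apply/orP; right; rewrite Eq.
  have t0 : (0 < t)%N by apply: ltnW.
  have l0 : (0 < l)%N by rewrite lt0n; apply: contraTneq q0 => l0; rewrite Eq l0 exp0n.
  have m1 : (1 < m)%N.
    rewrite ltnNge; apply/negP => m1; have : (m ^ t <= 1)%N by case: (m) m1 => [|[]] //; rewrite ?exp1n ?exp0n.
    by rewrite -Ek leqNgt k1.
  apply: (@mem_power_values (fun t l => tower_base k (l ^ t)) _ _ t m l) => //.
  - by rewrite t1 (exponent_lt k t m) // -Ek leq_pmulr.
  - rewrite l0; apply: (ratio_power_le m l t) => //.
    by rewrite -Ek -Eq; case/andP: rg.
  - by move: kq; rewrite Ek Eq coprime_pexpl // coprime_pexpr.
have phi0 : 0 < (prime.totient k)%:R :> R by rewrite ltr0n totient_gt0.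
have s0 : 0 < Num.sqrt k%:R :> R by rewrite sqrtr_gt0.
have -> : (size s)%:R / (prime.totient k)%:R - (exp 1 - (exp 1)^-1) =
  ((size s)%:R - (exp 1 - (exp 1)^-1) * (prime.totient k)%:R) / (prime.totient k)%:R.
  by rewrite mulrBl mulfK ?gt_eqF.
rewrite normrM normfV (gtr0_norm phi0) ler_pdivrMr //.
have -> : (C + 96) / Num.sqrt k%:R * (prime.totient k)%:R =
   C * (prime.totient k)%:R / Num.sqrt k%:R + 96 * (prime.totient k)%:R / Num.sqrt k%:R by ring.
move: up lo; rewrite -!(ler_nat R) !natrD => up lo.
move: main_size; rewrite !ler_norml; lra.
Qed.

Lemma In_mem (s : seq R) (A : R) : In A s <-> A \in s.
Proof.
elim: s => [|B s IH] //=; rewrite inE; split=> [[->|/IH ->]|/predU1P[->|/IH]].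
- by rewrite eqxx.
- by rewrite orbT.
- by left.
- by right.
Qed.

Lemma NoDup_uniq (s : seq R) : uniq s -> NoDup s.
Proof.
elim: s => [|A s IH] /=; first by constructor.
by case/andP=> As /IH; constructor => // /In_mem; apply/negP.
Qed.

Lemma Qset_enumeration : exists C : R, Rlt 0 C /\ forall k : nat, (3 <= k)%coq_nat ->
  exists l : list R, [/\ NoDup l, forall A, In A l <-> Qset k A &
    Rle (Rabs (INR (length l) / INR (Defs.totient k) - (exp 1 - / exp 1))) (C * / sqrt (INR k))].
Proof.
have [C /RltP C0 HC] := Qset_count; exists C; split=> // k /ssrnat.leP k3.
have [s [us sQ Hs]] := HC k k3; exists s; split; first exact: NoDup_uniq.
  by move=> A; rewrite In_mem.
rewrite totient_totient; last exact: leq_trans k3.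
by apply/RleP; rewrite RabsE RsqrtE !INRE.
Qed.

Lemma exp1_lt3 : Rlt (exp 1) 3.
Proof.
apply/RltP; have := exp_m1_gt3; rewrite exp_m1E ltf_pV2 ?posrE ?exp_gt0 //.
Qed.

End RationalHeights.

Lemma ln_3_gt1 : 1 < ln 3.
Proof.
rewrite <- (ln_exp 1). apply ln_increasing; [apply exp_pos|apply RationalHeights.exp1_lt3].
Qed.

Theorem theorem2p3 :
  exists C : R, 0 < C /\
  forall k : nat, (3 <= k)%nat ->
    exists l : list R,
      NoDup l /\ (forall A : R, In A l <-> Qset k A) /\
      Rabs (INR (length l) / INR (totient k) - (exp 1 - / exp 1))
        <= C * (/ sqrt (INR k)) * ln (ln (INR k)).
Proof.
destruct RationalHeights.Qset_enumeration as [C [C0 HC]].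
assert (l3 := ln_3_gt1).
assert (0 < ln (ln 3)) as c0 by (rewrite <- ln_1; apply ln_increasing; lra).
(* For [k >= 3], [ln (ln k) >= ln (ln 3) > 0], so the bound [C / sqrt k] is at most this constant
   times [ln (ln k) / sqrt k]. *)
exists (C / ln (ln 3)). split; [now apply Rdiv_lt_0_compat|].
intros k k3. destruct (HC k k3) as [l [Hl1 Hl2 Hl3]].
exists l. split; [trivial|split; [trivial|]].
eapply Rle_trans; [exact Hl3|].
assert (3 <= INR k) as kR by (apply le_INR in k3; simpl in k3; lra).
assert (0 < sqrt (INR k)) as s0 by (apply sqrt_lt_R0; lra).
assert (0 < / sqrt (INR k)) by now apply Rinv_0_lt_compat.
assert (1 <= ln (ln (INR k)) / ln (ln 3)) as L.
{ apply (Rmult_le_reg_r (ln (ln 3))); [trivial|].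
  unfold Rdiv. rewrite Rmult_assoc, Rinv_l, Rmult_1_l, Rmult_1_r by lra.
  destruct kR as [kR| <-]; [|lra].
  left. apply ln_increasing; [|apply ln_increasing]; lra. }
replace (C / ln (ln 3) * / sqrt (INR k) * ln (ln (INR k)))
  with (C * / sqrt (INR k) * (ln (ln (INR k)) / ln (ln 3))) by (field; lra).
rewrite <- (Rmult_1_r (C * / sqrt (INR k))) at 1.
apply Rmult_le_compat_l; [nra|trivial].
Qed.
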